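(* Let $n\ge1$. (1) For any welded $n$-string link $L$, the welded multi-variable Tong-Yang-Ma matrix $w\mathcal{TYM}_n(L)$ is an invariant of $L$ (it depends only on the welded equivalence class). (2) For all welded $n$-string links $L$ and $L'$, $$w\mathcal{TYM}_n(LL')=w\mathcal{TYM}_n(L)\,\bigl(L\cdot w\mathcal{TYM}_n(L')\bigr),$$ where $L\cdot$ denotes the entrywise action on $\mathrm{GL}_n(\mathbb{Z}[\widetilde\Lambda_n])$ determined by $L\cdot u_j=u_{\tau_L(j)}$, $L\cdot v_j=v_{\tau_L(j)}$, $L\cdot\alpha_j=\alpha_{\tau_L(j)}$, with $\tau_L(j)=i_j$ when the string of $L$ ending at $z_j\times\{1\}$ is the $i_j$-th string.
   Context: Welded string links. Fix reals $0<z_1<\dots<z_n<1$. A virtual $n$-string link diagram is an immersion of $n$ oriented intervals in $[0,1]\times[0,1]$ such that each initial point is some $z_i\times\{0\}$ (drawn at the top) and each endpoint some $z_j\times\{1\}$ (drawn at the bottom), whose singularities are finitely many transverse double points, each labelled as a positive crossing, a negative crossing (classical crossings) or a virtual crossing. The interval starting at $z_i\times\{0\}$ is the $i$-th string. A welded $n$-string link is an equivalence class of such diagrams under planar isotopy, the Reidemeister moves R1, R2, R3, the virtual Reidemeister moves (the analogues of R1, R2, R3 with all crossings virtual), the mixed move (a strand with only virtual crossings moves across a classical crossing), and the over-commute (OC) move (a strand passing over two others moves across a virtual crossing of those two). Welded $n$-string links form a monoid $w\mathcal{SL}_n$ under concatenation ($LL'$ is $L$ followed by $L'$). $\widetilde\Lambda_n$-groups.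 $\widetilde\Lambda_n$ is the free abelian group (written multiplicatively) on $u_1,\dots,u_n,v_1,\dots,v_n,\alpha_1,\dots,\alpha_n$. A $\widetilde\Lambda_n$-group is a group with a right action of $\widetilde\Lambda_n$ by automorphisms, $(g,w)\mapsto g^w$. A $\widetilde\Lambda_n$-presentation has, for each $\widetilde\Lambda_n$-generator, a family of group generators indexed by $\widetilde\Lambda_n\cong\mathbb{Z}^{3n}$ permuted by translation, and each relation stands for all its translates. Let $D$ be a diagram of $L$. Cut every string at every crossing (classical over, classical under, and virtual) and label the resulting edges; the top edges are $a_1,\dots,a_n$ and the bottom edges $x_1,\dots,x_n$ from left to right (if the same edge is top edge $i$ and bottom edge $j$, the relation $x_j=a_i$ is imposed). $wK_n$ is the $\widetilde\Lambda_n$-group with these labels as generators and the relations: at a classical crossing of sign $\varepsilon$ where the $j$-th string passes over the $i$-th (possibly $i=j$), if the under-string enters along $e$ and leaves along $e'$ and the over-string enters along $f$ and leaves along $f'$, then $e'=e^{u_j^{\varepsilon}}$ and $f'=f^{v_i^{\varepsilon}}$; at a virtual crossing, rotated so that both strings point downwards, if the $i$-th string goes from left (edge $e$) to right (edge $e'$) and the $j$-th string from right (edge $f$) to left (edge $f'$), then $e'=e^{\alpha_j^{-1}}$ and $f'=f^{\alpha_i}$. Eliminating the other generators, $wK_n=\langle a_1,\dots,a_n,x_1,\dots,x_n\mid x_j=a_{i_j}^{w_j},\ 1\le j\le n\rangle$ with $w_j\in\widetilde\Lambda_n$. Define $w\widetilde K_n=\langle a_1,\dots,a_n,x_1,\dots,x_n\mid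 x_j=a_{i_j}^{w_j(u_{i_j}v_{i_j})^{-k_j}},\ 1\le j\le n\rangle$, where $k_j$ is the sum of the signs of the classical self-crossings of the $i_j$-th string. Its abelianization is a free $\mathbb{Z}[\widetilde\Lambda_n]$-module of rank $n$ with ordered bases $\mathcal S=(a_1,\dots,a_n)$ and $\mathcal T=(x_1,\dots,x_n)$, and $w\mathcal{TYM}_n(L)\in\mathrm{GL}_n(\mathbb{Z}[\widetilde\Lambda_n])$ is the change of basis matrix with $\mathcal S\,w\mathcal{TYM}_n(L)=\mathcal T$. *)

(* Defs.v *)
From HB Require Import structures.
From mathcomp Require Import all_boot all_order all_algebra perm finmap.
From mathcomp Require Import generic_quotient.
From mathcomp Require Import all_classical all_reals topology normedtype derive.
From mathcomp Require Import ring lra.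

Set Implicit Arguments.
Unset Strict Implicit.
Unset Printing Implicit Defensive.

Import Order.TTheory GRing.Theory Num.Theory numFieldNormedType.Exports.

Local Open Scope ring_scope.

Local Open Scope classical_set_scope.
Local Open Scope quotient_scope.
(* The group ring Z[G] of an abelian group G, written additively: the basis   *)
(* element of Z[G] given by k : G is zbase k, and a group element written     *)
(* multiplicatively in the source is an element of the additive group G here. *)
Section GroupRing.
Variable G : zmodType.

Definition zgring : Type := {fsfun G -> int with 0}.
HB.instance Definition _ := Choice.on zgring.
Implicit Types (f g h : zgring) (k l : G).

Definition zcoef f k : int := (f : {fsfun G -> int with 0}) k.
Definition zbase k : zgring := [fsfun x in [fset k]%fset => 1%:Z].
Definition zzero : zgring := [fsfun].
Definition zopp f : zgring := [fsfun x in finsupp f => - zcoef f x].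
Definition zadd f g : zgring :=
  [fsfun x in (finsupp f `|` finsupp g)%fset => zcoef f x + zcoef g x].

Lemma zgringP f g : zcoef f =1 zcoef g -> f = g.
Proof. by move=> e; apply/fsfunP. Qed.

Lemma zcoef_base k l : zcoef (zbase k) l = (l == k)%:R.
Proof. by rewrite /zcoef /zbase fsfunE inE; case: eqP. Qed.

Lemma zcoef_zero k : zcoef zzero k = 0.
Proof. by rewrite /zcoef fsfun0E. Qed.

Lemma zcoef_opp f k : zcoef (zopp f) k = - zcoef f k.
Proof.
rewrite /zcoef /zopp fsfunE; case: ifPn => // h.
by rewrite (fsfun_dflt h) oppr0.
Qed.

Lemma zcoef_add f g k : zcoef (zadd f g) k = zcoef f k + zcoef g k.
Proof.
rewrite /zcoef /zadd fsfunE inE; case: ifPn => //.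
by rewrite negb_or => /andP[h1 h2]; rewrite (fsfun_dflt h1) (fsfun_dflt h2).
Qed.

Lemma zaddA : associative zadd.
Proof. by move=> f g h; apply/zgringP => k; rewrite !zcoef_add addrA. Qed.

Lemma zaddC : commutative zadd.
Proof. by move=> f g; apply/zgringP => k; rewrite !zcoef_add addrC. Qed.

Lemma zadd0 : left_id zzero zadd.
Proof.
by move=> f; apply/zgringP => k; rewrite zcoef_add zcoef_zero add0r.
Qed.

Lemma zaddN : left_inverse zzero zopp zadd.
Proof.
by move=> f; apply/zgringP => k; rewrite zcoef_add zcoef_opp zcoef_zero addNr.
Qed.

HB.instance Definition _ := GRing.isZmodule.Build zgring zaddA zaddC zadd0 zaddN.

(* The additive extension to Z[G] of a map defined on G *)
Definition zext (V : zmodType) (phi : G -> V) (f : zgring) : V :=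
  \sum_(k <- finsupp f) phi k *~ zcoef f k.

Lemma zext_sup (V : zmodType) (phi : G -> V) (f : zgring) (S : {fset G}) :
  {subset finsupp f <= S} -> zext phi f = \sum_(k <- S) phi k *~ zcoef f k.
Proof.
move=> sub; apply/big_fset_incl; first exact/fsubsetP.
by move=> k _ h; rewrite /zcoef (fsfun_dflt h) mulr0z.
Qed.

Lemma zext_is_additive (V : zmodType) (phi : G -> V) :
  {morph zext phi : f g / f - g}.
Proof.
move=> f g; pose S := (finsupp f `|` finsupp g `|` finsupp (f - g))%fset.
rewrite !(@zext_sup _ _ _ S); first last.
- by move=> k kfg; rewrite in_fsetU kfg orbT.
- by move=> k kf; rewrite !in_fsetU kf.
- by move=> k kg; rewrite !in_fsetU kg orbT.
rewrite -sumrB; apply: eq_bigr => k _.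
by rewrite -mulrzBr -zcoef_opp -zcoef_add.
Qed.

HB.instance Definition _ (V : zmodType) (phi : G -> V) :=
  GRing.isZmodMorphism.Build zgring V (zext phi) (zext_is_additive phi).

Lemma zext_base (V : zmodType) (phi : G -> V) k : zext phi (zbase k) = phi k.
Proof.
rewrite (@zext_sup _ _ _ [fset k]%fset) ?big_seq_fset1 ?zcoef_base ?eqxx //.
move=> l; rewrite mem_finsupp -/(zcoef _ l) zcoef_base inE.
by case: (l == k); rewrite ?eqxx.
Qed.

Lemma eq_zext (V : zmodType) (phi psi : G -> V) :
  phi =1 psi -> zext phi =1 zext psi.
Proof. by move=> e f; apply: eq_bigr => k _; rewrite e. Qed.

Lemma zext_id f : zext zbase f = f.
Proof.
apply/zgringP => k.
have cadd : {morph zcoef^~ k : f g / f + g} by move=> x y; exact: zcoef_add.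
have c0 : zcoef 0 k = 0 by exact: zcoef_zero.
rewrite /zext (big_morph _ cadd c0).
have cz x (m : int) : zcoef (x *~ m) k = zcoef x k *~ m.
  have cn p : zcoef (x *+ p) k = zcoef x k *+ p.
    by elim: p => [|p IH]; rewrite ?mulr0n // !mulrS cadd IH.
  case: m => p; rewrite ?NegzE -?pmulrn ?mulrNz -?pmulrn //.
  by rewrite -[X in zcoef X _]/(zopp _) zcoef_opp cn.
under eq_bigr => l _ do rewrite cz zcoef_base.
have [kf|kf] := boolP (k \in finsupp f).
  rewrite (big_fsetD1 k) //= eqxx big1_fset ?addr0 ?intz // => l.
  by rewrite !inE eq_sym => /andP[/negPf -> _] _; rewrite mul0rz.
rewrite big1_fset; first by rewrite /zcoef (fsfun_dflt kf).
move=> l lf _; case: eqP => [e|_]; last by rewrite mul0rz.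
by rewrite e lf in kf.
Qed.

(* Two additive maps that agree on the basis are equal. *)
Lemma zext_ext (V : zmodType) (phi psi : {additive zgring -> V}) :
  (forall k, phi (zbase k) = psi (zbase k)) -> phi =1 psi.
Proof.
move=> e f; rewrite -(zext_id f) /zext !raddf_sum; apply: eq_bigr => k _.
by rewrite !raddfMz e.
Qed.

Lemma zext_comp (V W : zmodType) (u : {additive V -> W}) (phi : G -> V) f :
  u (zext phi f) = zext (u \o phi) f.
Proof. by rewrite /zext raddf_sum; apply: eq_bigr => k _; rewrite raddfMz. Qed.

Lemma zextD (V : zmodType) (phi psi : G -> V) f :
  zext (fun k => phi k + psi k) f = zext phi f + zext psi f.
Proof. by rewrite /zext -big_split /=; apply: eq_bigr => k _; rewrite mulrzDl. Qed.

Definition zmul f g : zgring := zext (fun k => zext (fun l => zbase (k + l)) g) f.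

Lemma zmulBl g : {morph zmul^~ g : f f' / f - f'}.
Proof. by move=> f f'; rewrite /zmul raddfB. Qed.

Lemma zmulC : commutative zmul.
Proof.
move=> f g; rewrite /zmul /zext.
under eq_bigr => k _ do rewrite mulrz_suml.
rewrite exchange_big /=; apply: eq_bigr => l _.
rewrite mulrz_suml; apply: eq_bigr => k _.
by rewrite addrC -!mulrzA mulrC.
Qed.

Lemma zmulBr f : {morph zmul f : g g' / g - g'}.
Proof. by move=> g g'; rewrite !(zmulC f) zmulBl. Qed.

Definition zmulr g f := zmul f g.
HB.instance Definition _ g :=
  GRing.isZmodMorphism.Build zgring zgring (zmulr g) (zmulBl g).
HB.instance Definition _ f :=
  GRing.isZmodMorphism.Build zgring zgring (zmul f) (zmulBr f).

Lemma zmul_base k l : zmul (zbase k) (zbase l) = zbase (k + l).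
Proof. by rewrite /zmul !zext_base. Qed.

Lemma zmulA : associative zmul.
Proof.
move=> f g h.
have e1 k l : zmul (zbase k) \o zmul (zbase l) =1 zmul (zmul (zbase k) (zbase l)).
  by apply: zext_ext => m /=; rewrite !zmul_base addrA.
have e2 k : zmul (zbase k) \o zmulr h =1 zmulr h \o zmul (zbase k).
  by apply: zext_ext => l /=; exact: e1.
have e3 : zmulr (zmul g h) =1 zmulr h \o zmulr g.
  by apply: zext_ext => k /=; exact: e2.
exact: e3.
Qed.

Lemma zmul1 : left_id (zbase 0) zmul.
Proof.
move=> f; apply: (zext_ext (phi := zmul (zbase 0)) (psi := idfun)) => k /=.
by rewrite zmul_base add0r.
Qed.

Lemma zmulDl : left_distributive zmul +%R.
Proof. by move=> f g h; exact: (raddfD (zmulr h)). Qed.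

Lemma zone_neq0 : zbase 0 != 0.
Proof.
apply/eqP => /(congr1 (zcoef^~ 0)); rewrite zcoef_base eqxx.
by rewrite -[0 in RHS]/zzero zcoef_zero.
Qed.

HB.instance Definition _ := GRing.Zmodule_isComNzRing.Build zgring
  zmulA zmulC zmul1 zmulDl zone_neq0.

Lemma zbaseD k l : zbase (k + l) = zbase k * zbase l.
Proof. by rewrite [RHS]zmul_base. Qed.

Lemma zbase0 : zbase 0 = 1.
Proof. by []. Qed.

End GroupRing.

(* Groups with a right action of A by automorphisms *)
HB.mixin Record Group_isActed (A : zmodType) G of Group G := {
  gact : G -> A -> G;
  gact0 : forall g, gact g 0 = g;
  gactD : forall g a b, gact g (a + b) = gact (gact g a) b;
  gactM : forall a, {morph gact^~ a : g h / (g * h)%g}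
}.

#[short(type="actGroupType")]
HB.structure Definition ActGroup (A : zmodType) :=
  {G of Group_isActed A G & Group G}.

(* The A-group presented by generators X and relations rel.  Its underlying   *)
(* group is generated by the letters (x, a), standing for x^a; the flag of a  *)
(* letter marks an inverse.  Every relation is imposed with its translates.   *)
Section Presentation.
Variables (A : zmodType) (X : choiceType).

Definition word : Type := seq (X * A * bool).
HB.instance Definition _ := Choice.on word.

Definition word_act (w : word) (a : A) : word :=
  [seq (l.1.1, l.1.2 + a, l.2) | l <- w].
Definition word_inv (w : word) : word := rev [seq (l.1, ~~ l.2) | l <- w].

Variable rel : word -> word -> Prop.

Inductive word_cong : word -> word -> Prop :=
| cong_refl w : word_cong w w
| cong_sym w w' : word_cong w w' -> word_cong w' w
| cong_trans w w' w'' : word_cong w w' -> word_cong w' w'' -> word_cong w w''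
| cong_cat v v' w w' :
    word_cong v v' -> word_cong w w' -> word_cong (v ++ w) (v' ++ w')
| cong_cancel x a b : word_cong [:: (x, a, b); (x, a, ~~ b)] [::]
| cong_rel v w a : rel v w -> word_cong (word_act v a) (word_act w a).

Lemma word_act0 w : word_act w 0 = w.
Proof. by rewrite -[RHS]map_id; apply: eq_map => -[[x a] b] /=; rewrite addr0. Qed.

Lemma word_actD w a b : word_act w (a + b) = word_act (word_act w a) b.
Proof.
by rewrite /word_act -map_comp; apply: eq_map => l /=; rewrite addrA.
Qed.

Lemma word_act_cat v w a : word_act (v ++ w) a = word_act v a ++ word_act w a.
Proof. exact: map_cat. Qed.

Lemma word_invK : involutive word_inv.
Proof.
move=> w; rewrite /word_inv map_rev revK -map_comp -[RHS]map_id.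
by apply: eq_map => -[y b] /=; rewrite negbK.
Qed.

Lemma word_inv_cat v w : word_inv (v ++ w) = word_inv w ++ word_inv v.
Proof. by rewrite /word_inv map_cat rev_cat. Qed.

Lemma cong_act v w a : word_cong v w -> word_cong (word_act v a) (word_act w a).
Proof.
elim=> [u|u u' _|u u' u'' _ + _|u u' v' w' _ + _|x b c|u u' b r].
- exact: cong_refl.
- exact: cong_sym.
- exact: cong_trans.
- by rewrite !word_act_cat; exact: cong_cat.
- exact: cong_cancel.
- by rewrite -!word_actD; exact: cong_rel.
Qed.

Lemma cong_mulV w : word_cong (w ++ word_inv w) [::].
Proof.
elim: w => [|[[x a] b] w IH]; first exact: cong_refl.
have -> : word_inv ((x, a, b) :: w) = word_inv w ++ [:: (x, a, ~~ b)].
  by rewrite -cat1s word_inv_cat.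
rewrite -cat1s -catA (catA w).
apply: cong_trans (cong_cancel x a b).
rewrite -[X in word_cong _ X]/([:: (x, a, b)] ++ [:: (x, a, ~~ b)]).
apply: cong_cat; first exact: cong_refl.
rewrite -[X in word_cong _ X]cat0s.
by apply: cong_cat IH _; exact: cong_refl.
Qed.

Lemma cong_Vmul w : word_cong (word_inv w ++ w) [::].
Proof. by rewrite -{2}[w]word_invK; exact: cong_mulV. Qed.

Lemma cong_inv v w : word_cong v w -> word_cong (word_inv v) (word_inv w).
Proof.
move=> vw; apply: (@cong_trans _ (word_inv v ++ (w ++ word_inv w))).
  rewrite -[X in word_cong X _]cats0; apply: cong_cat; first exact: cong_refl.
  exact/cong_sym/cong_mulV.
rewrite catA -[X in word_cong _ X]cat0s.
apply: cong_cat; last exact: cong_refl.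
apply: cong_trans (cong_Vmul v).
by apply: cong_cat; [exact: cong_refl | exact: cong_sym].
Qed.

Definition word_congb (v w : word) : bool := `[< word_cong v w >].

Lemma word_congb_refl : reflexive word_congb.
Proof. by move=> w; apply/asboolP; exact: cong_refl. Qed.

Lemma word_congb_sym : symmetric word_congb.
Proof. by move=> v w; apply/asboolP/asboolP => h; exact: cong_sym. Qed.

Lemma word_congb_trans : transitive word_congb.
Proof.
move=> v u w /asboolP h /asboolP h'.
by apply/asboolP; exact: cong_trans h h'.
Qed.

Canonical word_cong_equiv :=
  EquivRel word_congb word_congb_refl word_congb_sym word_congb_trans.

Definition presented : Type := {eq_quot word_cong_equiv}.
HB.instance Definition _ := Choice.on presented.

Definition pclass (w : word) : presented := \pi_{eq_quot word_cong_equiv} w.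
Definition prepr (g : presented) : word :=
  repr (g : {eq_quot word_cong_equiv}).

Lemma preprK : cancel prepr pclass.
Proof. by move=> g; exact: reprK. Qed.

Lemma pclassP v w : pclass v = pclass w <-> word_cong v w.
Proof.
split=> [/eqmodP /asboolP //|h]; apply/eqmodP.
exact/asboolP.
Qed.

Lemma prepr_cong w : word_cong (prepr (pclass w)) w.
Proof. by apply/pclassP; rewrite preprK. Qed.

Definition pgen (x : X) : presented := pclass [:: (x, 0, false)].
Definition pone : presented := pclass [::].
Definition pmul (g h : presented) : presented := pclass (prepr g ++ prepr h).
Definition pinv (g : presented) : presented := pclass (word_inv (prepr g)).
Definition pact (g : presented) (a : A) : presented :=
  pclass (word_act (prepr g) a).

Lemma pmulE v w : pmul (pclass v) (pclass w) = pclass (v ++ w).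
Proof. by apply/pclassP; apply: cong_cat; exact: prepr_cong. Qed.

Lemma pinvE w : pinv (pclass w) = pclass (word_inv w).
Proof. by apply/pclassP; apply: cong_inv; exact: prepr_cong. Qed.

Lemma pactE w a : pact (pclass w) a = pclass (word_act w a).
Proof. by apply/pclassP; apply: cong_act; exact: prepr_cong. Qed.

Lemma pmulA : associative pmul.
Proof.
move=> f g h; rewrite -(preprK f) -(preprK g) -(preprK h).
by rewrite !pmulE catA.
Qed.

Lemma pmul1 : left_id pone pmul.
Proof. by move=> g; rewrite -(preprK g) pmulE. Qed.

Lemma pmulr1 : right_id pone pmul.
Proof. by move=> g; rewrite -(preprK g) pmulE cats0. Qed.

Lemma pmulV : left_inverse pone pinv pmul.
Proof.
move=> g; rewrite -(preprK g) pinvE pmulE.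
by apply/pclassP; exact: cong_Vmul.
Qed.

Lemma pmulrV : right_inverse pone pinv pmul.
Proof.
move=> g; rewrite -(preprK g) pinvE pmulE.
by apply/pclassP; exact: cong_mulV.
Qed.

HB.instance Definition _ :=
  isGroup.Build presented pmulA pmul1 pmulr1 pmulV pmulrV.

Lemma pact0 g : pact g 0 = g.
Proof. by rewrite -(preprK g) pactE word_act0. Qed.

Lemma pactD g a b : pact g (a + b) = pact (pact g a) b.
Proof. by rewrite -(preprK g) !pactE word_actD. Qed.

Lemma pactM a : {morph pact^~ a : g h / (g * h)%g}.
Proof.
move=> g h; rewrite -(preprK g) -(preprK h).
change (pact (pmul (pclass (prepr g)) (pclass (prepr h))) a =
        pmul (pact (pclass (prepr g)) a) (pact (pclass (prepr h)) a)).
by rewrite pmulE !pactE pmulE word_act_cat.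
Qed.

HB.instance Definition _ := Group_isActed.Build A presented pact0 pactD pactM.

End Presentation.

(* The abelianization of an A-group, as a module over the group ring Z[A] *)
Section Abelianization.
Variables (A : zmodType) (H : actGroupType A).

Inductive derived : H -> Prop :=
| derived1 : derived 1%g
| derivedM g h : derived g -> derived h -> derived (g * h)%g
| derivedV g : derived g -> derived g^-1%g
| derivedR g h : derived (g^-1 * h^-1 * g * h)%g.

Lemma derivedJ g h : derived g -> derived (h^-1 * g * h)%g.
Proof.
move=> dg; have -> : (h^-1 * g * h = g * (g^-1 * h^-1 * g * h))%g.
  by rewrite !mulgA mulgV mul1g.
by apply: derivedM => //; exact: derivedR.
Qed.

Lemma gact1 a : gact (1 : H)%g a = 1%g.
Proof. by apply: (mulgI (gact (1 : H)%g a)); rewrite -gactM !mulg1. Qed.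

Lemma gactV (g : H) a : gact g^-1%g a = (gact g a)^-1%g.
Proof. by apply: (mulgI (gact g a)); rewrite -gactM !mulgV gact1. Qed.

Lemma derived_act g a : derived g -> derived (gact g a).
Proof.
elim=> [|x y _ + _|x _|x y]; rewrite ?gact1 ?gactM ?gactV.
- exact: derived1.
- exact: derivedM.
- exact: derivedV.
- exact: derivedR.
Qed.

Definition abel_rel (g h : H) : bool := `[< derived (g^-1 * h)%g >].

Lemma abel_rel_refl : reflexive abel_rel.
Proof. by move=> g; apply/asboolP; rewrite mulVg; exact: derived1. Qed.

Lemma abel_rel_sym : symmetric abel_rel.
Proof.
by move=> g h; apply/asboolP/asboolP => /derivedV; rewrite invgM invgK.
Qed.

Lemma abel_rel_trans : transitive abel_rel.
Proof.
move=> h g k /asboolP dgh /asboolP dhk; apply/asboolP.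
by have := derivedM dgh dhk; rewrite mulgA mulgK.
Qed.

Canonical abel_equiv :=
  EquivRel abel_rel abel_rel_refl abel_rel_sym abel_rel_trans.

Definition abel : Type := {eq_quot abel_equiv}.
HB.instance Definition _ := Choice.on abel.

Definition abel_pi (g : H) : abel := \pi_{eq_quot abel_equiv} g.
Definition abel_repr (m : abel) : H := repr (m : {eq_quot abel_equiv}).

Lemma abel_reprK : cancel abel_repr abel_pi.
Proof. by move=> m; exact: reprK. Qed.

Lemma abel_piP g h : abel_pi g = abel_pi h <-> derived (g^-1 * h)%g.
Proof.
split=> [/eqmodP /asboolP //|d]; apply/eqmodP.
exact/asboolP.
Qed.

Lemma abel_repr_derived g : derived ((abel_repr (abel_pi g))^-1 * g)%g.
Proof. by apply/abel_piP; rewrite abel_reprK. Qed.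

Definition abel_zero : abel := abel_pi 1%g.
Definition abel_add (m n : abel) : abel :=
  abel_pi (abel_repr m * abel_repr n)%g.
Definition abel_opp (m : abel) : abel := abel_pi (abel_repr m)^-1%g.
Definition abel_act (a : A) (m : abel) : abel := abel_pi (gact (abel_repr m) a).

Lemma abel_addE g h : abel_add (abel_pi g) (abel_pi h) = abel_pi (g * h)%g.
Proof.
apply/abel_piP; set g' := abel_repr _; set h' := abel_repr _.
have -> : ((g' * h')^-1 * (g * h) = (h'^-1 * (g'^-1 * g) * h') * (h'^-1 * h))%g.
  by rewrite invgM !mulgA mulgK.
by apply: derivedM; [apply: derivedJ|]; exact: abel_repr_derived.
Qed.

Lemma abel_oppE g : abel_opp (abel_pi g) = abel_pi g^-1%g.
Proof.
apply/abel_piP; rewrite invgK; set g' := abel_repr _.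
have := derivedJ (g'^-1)%g (derivedV (abel_repr_derived g)).
by rewrite invgM !invgK -/g' -!mulgA mulgV mulg1.
Qed.

Lemma abel_actE a g : abel_act a (abel_pi g) = abel_pi (gact g a).
Proof.
apply/abel_piP; rewrite -gactV -gactM.
by apply: derived_act; exact: abel_repr_derived.
Qed.

Lemma abel_addA : associative abel_add.
Proof.
move=> l m n; rewrite -(abel_reprK l) -(abel_reprK m) -(abel_reprK n).
by rewrite !abel_addE mulgA.
Qed.

Lemma abel_addC : commutative abel_add.
Proof.
move=> m n; rewrite -(abel_reprK m) -(abel_reprK n) !abel_addE.
by apply/abel_piP; rewrite invgM mulgA; exact: derivedR.
Qed.

Lemma abel_add0 : left_id abel_zero abel_add.
Proof. by move=> m; rewrite -(abel_reprK m) abel_addE mul1g. Qed.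

Lemma abel_addN : left_inverse abel_zero abel_opp abel_add.
Proof. by move=> m; rewrite -(abel_reprK m) abel_oppE abel_addE mulVg. Qed.

HB.instance Definition _ :=
  GRing.isZmodule.Build abel abel_addA abel_addC abel_add0 abel_addN.

Lemma abel_actB a : {morph abel_act a : m n / m - n}.
Proof.
move=> m n; rewrite -(abel_reprK m) -(abel_reprK n).
rewrite -[RHS]/(abel_add _ (abel_opp _)) -[_ - _]/(abel_add _ (abel_opp _)).
by rewrite !(abel_oppE, abel_addE, abel_actE) gactM gactV.
Qed.

HB.instance Definition _ a :=
  GRing.isZmodMorphism.Build abel abel (abel_act a) (abel_actB a).

Lemma abel_actD a b m : abel_act (a + b) m = abel_act b (abel_act a m).
Proof. by rewrite -(abel_reprK m) !abel_actE gactD. Qed.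

Lemma abel_act0 m : abel_act 0 m = m.
Proof. by rewrite -(abel_reprK m) abel_actE gact0. Qed.

Definition abel_scale (r : zgring A) (m : abel) : abel :=
  zext (abel_act^~ m) r.

Lemma abel_scaleDr : right_distributive abel_scale +%R.
Proof.
move=> r m n; rewrite /abel_scale -zextD.
by apply: eq_zext => a; exact: raddfD.
Qed.

Lemma abel_scaleDl m : {morph abel_scale^~ m : r s / r + s}.
Proof. by move=> r s; exact: raddfD. Qed.

Lemma abel_scale1 : left_id 1 abel_scale.
Proof. by move=> m; rewrite /abel_scale -zbase0 zext_base abel_act0. Qed.

Lemma abel_scale_act a r m :
  abel_act a (abel_scale r m) = abel_scale r (abel_act a m).
Proof.
rewrite /abel_scale zext_comp; apply: eq_zext => b /=.
by rewrite -!abel_actD addrC.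
Qed.

Lemma abel_scaleA r s m :
  abel_scale r (abel_scale s m) = abel_scale (r * s) m.
Proof.
rewrite -[RHS]/(zext _ (zmul r s)) /zmul zext_comp.
apply: eq_zext => a /=.
rewrite abel_scale_act [RHS]zext_comp; apply: eq_zext => b /=.
by rewrite zext_base abel_actD.
Qed.

HB.instance Definition _ := GRing.Zmodule_isLmodule.Build (zgring A) abel
  abel_scaleA abel_scale1 abel_scaleDr abel_scaleDl.

Lemma abel_scaleE a (m : abel) : zbase a *: m = abel_act a m.
Proof. exact: zext_base. Qed.

End Abelianization.

Section Smooth.
Context {R : realType} {V W : normedModType R}.

(* C^k maps; on the finite-dimensional spaces used below (products of copies  *)
(* of R), requiring all directional derivatives is the usual notion.          *)
Fixpoint Cn (k : nat) (f : V -> W) : Prop :=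
  if k is k'.+1 then
    (forall p, differentiable f p) /\ (forall v, Cn k' (fun p => 'D_v f p))
  else continuous f.

Definition smooth (f : V -> W) : Prop := forall k, Cn k f.

Lemma smooth_differentiable f : smooth f -> forall p, differentiable f p.
Proof. by move=> /(_ 1)[]. Qed.

End Smooth.

Section LineMaps.
Context {R : realType}.

Lemma Cn_local (W : normedModType R) k (f : R -> W) :
  (forall t : R, exists2 g, Cn k g & \forall s \near t, g s = f s) -> Cn k f.
Proof.
elim: k f => [|k IH] f loc.
  move=> t; have [g cg gf] := loc t.
  rewrite /continuous_at -(nbhs_singleton gf).
  apply: cvg_trans (cg t); apply: near_eq_cvg; exact: gf.
split=> [t|v].
  have [g [dg _] gf] := loc t.
  apply/derivable1_diffP; apply: near_eq_derivable gf _.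
  exact/derivable1_diffP.
apply: IH => t; have [g [_ cg] gf] := loc t.
exists (fun p => 'D_v g p); first exact: cg.
apply: filterS (@near_join _ _ _ gf) => s gfs.
exact: near_eq_derive.
Qed.

(* The affine maps of the plane used to stack diagrams *)
Definition squash (c d : R) (p : R * R) : R * R := (p.1, c * p.2 + d).

Lemma squash0_linear c : linear (squash c 0).
Proof.
move=> a p q; rewrite /squash; congr pair => /=; rewrite !addr0 mulrDr.
by congr (_ + _); exact: mulrCA.
Qed.

HB.instance Definition _ c :=
  GRing.isLinear.Build R (R * R)%type (R * R)%type *:%R (squash c 0)
    (squash0_linear c).

Lemma continuous_squash c d : continuous (squash c d).
Proof.
move=> p.
have c1 : (fun q : R * R => q.1) @ p --> p.1 by exact: cvg_fst.
have c2 : (fun q : R * R => c * q.2 + d) @ p --> c * p.2 + d.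
  apply: cvgD; last exact: cvg_cst.
  by apply: cvgM; [exact: cvg_cst|exact: cvg_snd].
exact: (cvg_pair c1 c2).
Qed.

Lemma is_diff_squash c d p : is_diff p (squash c d) (squash c 0).
Proof.
have -> : squash c d = squash c 0 + cst (0, d).
  by apply/funext => q; rewrite /squash; congr pair; rewrite /= ?addr0.
have -> : squash c 0 = squash c 0 + (0 : R * R -> R * R).
  by apply/funext => q; rewrite [RHS]addr0.
rewrite [X in is_diff _ (X + _)]addr0.
apply: is_diffD; apply: DiffDef.
- exact/linear_differentiable/continuous_squash.
- exact/diff_lin/continuous_squash.
Qed.

Lemma is_diff_affine a b (t : R) : is_diff t (fun s => a * s + b) (fun s => a * s).
Proof.
have -> : (fun s => a * s + b) = *%R a + cst b by [].
have -> : (fun s => a * s) = *%R a + (0 : R -> R).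
  by apply/funext => s; rewrite [RHS]addr0.
apply: is_diffD; exact: is_diff_scaler.
Qed.

Section Rescale.
Variables (f : R -> R * R) (a b c d : R).

Lemma is_diff_rescale t : differentiable f (a * t + b) ->
  is_diff t (fun s => squash c d (f (a * s + b)))
    (squash c 0 \o 'd f (a * t + b) \o ( *%R a)).
Proof.
move=> df; apply: (@is_diff_comp _ _ _ _ (f \o (fun s => a * s + b)) _ (squash c d)).
  apply: (@is_diff_comp _ _ _ _ (fun s => a * s + b) _ f).
    exact: is_diff_affine.
  exact: DiffDef.
exact: is_diff_squash.
Qed.

Lemma derive_rescale t v : differentiable f (a * t + b) ->
  'D_v (fun s => squash c d (f (a * s + b))) t =
  squash c 0 ('D_(a * v) f (a * t + b)).
Proof.
move=> df; have F := is_diff_rescale df.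
have [dF eF] := F.
apply: (etrans (deriveE v dF)).
rewrite eF.
exact: (congr1 (squash c 0) (esym (deriveE (a * v) df))).
Qed.

End Rescale.

Lemma Cn_rescale k (f : R -> R * R) (a b c d : R) :
  Cn k f -> Cn k (fun s : R => squash c d (f (a * s + b))).
Proof.
elim: k f d => [|k IH] f d.
  move=> cf t; apply: continuous_comp; last exact: continuous_squash.
  apply: continuous_comp; last exact: cf.
  by apply: differentiable_continuous; have [] := is_diff_affine a b t.
move=> [df cf]; split=> [t|v]; first by have [] := @is_diff_rescale f a b c d t _.
have -> : (fun p => 'D_v (fun s => squash c d (f (a * s + b))) p) =
          (fun s : R => squash c 0 ('D_(a * v) f (a * s + b))).
  by apply/funext => t; exact: derive_rescale.
exact: (IH _ _ (cf (a * v))).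
Qed.

Lemma derive_scale (f : R -> R * R) a t :
  differentiable f t -> 'D_a f t = a *: 'D_1 f t.
Proof. by move=> df; rewrite !deriveE // -linearZ /= [a *: 1]mulr1. Qed.

End LineMaps.

(* A virtual crossing is labelled Virt. *)
Inductive crossing_label := Pos | Neg | Virt.

Definition label_sign (l : crossing_label) : int :=
  match l with Pos => 1 | Neg => -1 | Virt => 0 end.

Section Diagrams.
Context {R : realType} {n : nat}.

Definition det2 (u v : R * R) : R := u.1 * v.2 - u.2 * v.1.

Definition open_square : set (R * R) :=
  [set p | 0 < p.1 < 1 /\ 0 < p.2 < 1].

(* The second coordinate of the plane points downwards in drawings, so that   *)
(* 0 < det2 u v means that v is clockwise from u in a drawing.                *)
(* The i-th string is the restriction of str i to [0,1]; str i prolongs it by *)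
(* vertical rays outside of the square, which creates no double point.        *)
(* Strings are vertical and parametrized by height near their ends, so that   *)
(* the concatenation of two diagrams is again smooth.                         *)
(* The i-th string ends at z_(bot i) * {1}.                                   *)
(* The value of lab is only relevant at double points.                        *)
Record vdiagram (z : 'I_n -> R) := VDiagram {
  str : 'I_n -> R -> R * R;
  bot : {perm 'I_n};
  lab : R * R -> crossing_label;
  str_smooth : forall i, smooth (str i);
  str_immersion : forall i t, 'D_1 (str i) t <> 0;
  str_top : forall i,
    exists2 e : R, 0 < e & forall t : R, t <= e -> str i t = (z i, t);
  str_bot : forall i,
    exists2 e : R, 0 < e & forall t : R, 1 - e <= t -> str i t = (z (bot i), t);
  str_inside : forall i t, 0 < t < 1 -> open_square (str i t);
  str_transverse : forall i s j t, (i, s) <> (j, t) -> str i s = str j t ->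
    det2 ('D_1 (str i) s) ('D_1 (str j) t) <> 0;
  str_double : forall i r j s k t, str i r = str j s -> str j s = str k t ->
    [\/ (i, r) = (j, s), (j, s) = (k, t) | (i, r) = (k, t)];
  str_finite : finite_set
    [set p | exists i s j t, [/\ (i, s) <> (j, t), str i s = p & str j t = p]]
}.

Section DiagramTheory.
Context {z : 'I_n -> R}.
Implicit Types D : vdiagram z.

Lemma str_le0 D i t : t <= 0 -> str D i t = (z i, t).
Proof. by have [e e0 h] := str_top D i => t0; apply: h; lra. Qed.

Lemma str_ge1 D i t : 1 <= t -> str D i t = (z (bot D i), t).
Proof. by have [e e0 h] := str_bot D i => t0; apply: h; lra. Qed.

Lemma str_lt1 D i t : ((str D i t).2 < 1) = (t < 1).
Proof.
have [t1|t1] := ltP t 1; last by rewrite str_ge1 //= ltNge t1.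
have [t0|t0] := leP t 0; first by rewrite str_le0 //=.
by have [] := @str_inside _ D i t _; [rewrite t0|move=> _ /andP[]].
Qed.

Lemma str_gt0 D i t : (0 < (str D i t).2) = (0 < t).
Proof.
have [t0|t0] := leP t 0; first by rewrite str_le0 //= ltNge t0.
have [t1|t1] := ltP t 1; last by rewrite str_ge1.
by have [] := @str_inside _ D i t _; [rewrite t0|move=> _ /andP[]].
Qed.

Lemma str_gt1 D i t : (1 < (str D i t).2) = (1 < t).
Proof.
have [t1|t1] := leP 1 t; first by rewrite str_ge1.
by rewrite !ltNge [t <= 1]ltW // ltW // str_lt1.
Qed.

Lemma str_lt0 D i t : ((str D i t).2 < 0) = (t < 0).
Proof.
have [t0|t0] := leP t 0; first by rewrite str_le0.
by rewrite !ltNge [0 <= t]ltW // ltW // str_gt0.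
Qed.

Lemma z_inside D i : 0 < z i < 1.
Proof.
have [e e0 he] := str_top D i.
have m1 : Num.min e 2^-1 <= e by rewrite ge_min lexx.
have m2 : Num.min e 2^-1 <= 2^-1 by rewrite ge_min lexx orbT.
have m0 : 0 < Num.min e 2^-1 by rewrite lt_min e0 invr_gt0 ltr0n.
have [] := @str_inside _ D i (Num.min e 2^-1) _; first by lra.
by rewrite he.
Qed.

Lemma z_inj D : injective z.
Proof.
move=> i j zij; have [//|/eqP ij] := eqVneq i j; exfalso.
have [e e0 he] := str_top D i; have [f f0 hf] := str_top D j.
have ne : (i, 0 : R) <> (j, 0) by case.
have e00 : str D i 0 = str D j 0 by rewrite !str_le0 // zij.
apply: (str_transverse ne e00).
have -> : 'D_1 (str D i) (0 : R) = 'D_1 (str D j) 0.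
  apply: near_eq_derive; near=> t.
  rewrite he ?hf ?zij //; apply: ltW; near: t; exact: lt_nbhsl.
by rewrite /det2 mulrC subrr.
Unshelve. all: by end_near. Qed.

End DiagramTheory.
End Diagrams.

(* The concatenation of D followed by D', drawn below D *)
Section Concatenation.
Context {R : realType} {n : nat} {z : 'I_n -> R}.
Variables D D' : vdiagram z.
Implicit Types (i j k : 'I_n) (r s t : R).

Let up : R * R -> R * R := squash 2^-1 0.
Let down : R * R -> R * R := squash 2^-1 2^-1.

Definition concat_str (i : 'I_n) (t : R) : R * R :=
  if t <= 2^-1 then up (str D i (2 * t + 0))
  else down (str D' (bot D i) (2 * t + - 1)).

Definition concat_lab (p : R * R) : crossing_label :=
  if p.2 <= 2^-1 then lab D (p.1, 2 * p.2) else lab D' (p.1, 2 * p.2 - 1).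

Let concat_mid i : exists2 e : R, 0 < e & forall t : R, 2^-1 - e < t < 2^-1 + e ->
  up (str D i (2 * t + 0)) = (z (bot D i), t) /\
  down (str D' (bot D i) (2 * t + - 1)) = (z (bot D i), t).
Proof.
have [e e0 he] := str_bot D i; have [f f0 hf] := str_top D' (bot D i).
exists (Num.min e f / 2); first by rewrite divr_gt0 // lt_min e0.
move=> t /andP[t1 t2].
have le1 : Num.min e f <= e by rewrite ge_min lexx.
have le2 : Num.min e f <= f by rewrite ge_min lexx orbT.
have -> : str D i (2 * t + 0) = (z (bot D i), 2 * t + 0) by apply: he; lra.
have -> : str D' (bot D i) (2 * t + - 1) = (z (bot D i), 2 * t + - 1).
  by apply: hf; lra.
by rewrite /up /down /squash /=; split; congr pair; field.
Qed.

Let concat_up i t : t <= 2^-1 ->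
  \forall s \near t, up (str D i (2 * s + 0)) = concat_str i s.
Proof.
have [e e0 he] := concat_mid i => t2.
near=> s; rewrite /concat_str; case: leP => // s2.
have ss : 2^-1 - e < s < 2^-1 + e.
  apply/andP; split; first lra.
  apply: (@lt_le_trans _ _ (t + e)); last lra.
  near: s; apply: lt_nbhsl; lra.
by have [-> ->] := he _ ss.
Unshelve. all: by end_near. Qed.

Let concat_down i t : 2^-1 <= t ->
  \forall s \near t, down (str D' (bot D i) (2 * s + - 1)) = concat_str i s.
Proof.
have [e e0 he] := concat_mid i => t2.
near=> s; rewrite /concat_str; case: leP => // s2.
have ss : 2^-1 - e < s < 2^-1 + e.
  apply/andP; split; last lra.
  apply: (@le_lt_trans _ _ (t - e)); first lra.
  near: s; apply: lt_nbhsr; lra.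
by have [-> ->] := he _ ss.
Unshelve. all: by end_near. Qed.

Let concat_strU i t : t <= 2^-1 -> concat_str i t = up (str D i (2 * t)).
Proof. by rewrite /concat_str addr0 => ->. Qed.

Let concat_strD i t : 2^-1 <= t ->
  concat_str i t = down (str D' (bot D i) (2 * t - 1)).
Proof. by move=> /(concat_down i) /nbhs_singleton. Qed.

Let concat_derU i t : t <= 2^-1 ->
  'D_1 (concat_str i) t = squash 2^-1 0 (2 *: 'D_1 (str D i) (2 * t)).
Proof.
move=> t2; rewrite -(near_eq_derive _ (concat_up i t2)).
have df := smooth_differentiable (str_smooth D i).
apply: (etrans (derive_rescale _ _ _ (df _))).
by rewrite addr0 mulr1 derive_scale.
Qed.

Let concat_derD i t : 2^-1 <= t -> 'D_1 (concat_str i) t =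
  squash 2^-1 0 (2 *: 'D_1 (str D' (bot D i)) (2 * t - 1)).
Proof.
move=> t2; rewrite -(near_eq_derive _ (concat_down i t2)).
have df := smooth_differentiable (str_smooth D' (bot D i)).
apply: (etrans (derive_rescale _ _ _ (df _))).
by rewrite mulr1 derive_scale.
Qed.

Let squash_inj d : injective (squash 2^-1 d : R * R -> R * R).
Proof.
move=> [x y] [x' y'] [-> e]; congr pair.
by have := e; rewrite /= => ?; lra.
Qed.

Let squash_neq0 (u : R * R) : u <> 0 -> squash 2^-1 0 (2 *: u) <> 0.
Proof.
move=> u0; rewrite -[X in _ <> X](linear0 (squash 2^-1 0)) => /squash_inj /eqP.
by rewrite scaler_eq0 pnatr_eq0 /= => /eqP.
Qed.

Let det2_squash (u v : R * R) :
  det2 (squash 2^-1 0 (2 *: u)) (squash 2^-1 0 (2 *: v)) = 2 * det2 u v.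
Proof.
have E (w : R * R) : 2 *: w = (2 * w.1, 2 * w.2) by case: w.
by rewrite !E /det2 /squash /=; field.
Qed.

Lemma concat_meet i s j t : concat_str i s = concat_str j t ->
  (s <= 2^-1 /\ t <= 2^-1 /\ str D i (2 * s) = str D j (2 * t)) \/
  (2^-1 <= s /\ 2^-1 <= t /\
     str D' (bot D i) (2 * s - 1) = str D' (bot D j) (2 * t - 1)).
Proof.
wlog st : i s j t / s <= t => [hw|].
  have [st|/ltW ts] := leP s t; first exact: hw.
  move=> /esym /(hw _ _ _ _ ts) [|] [h1] [h2 /esym h3]; by [left|right].
have [t2|t2] := leP t 2^-1.
  have s2 := le_trans st t2.
  rewrite !concat_strU // => /squash_inj e; by left.
have [s2|s2] := leP 2^-1 s.
  rewrite !concat_strD // ?(ltW t2) // => /squash_inj e.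
  by right; split=> //; split=> //; exact: ltW.
rewrite concat_strU ?(ltW s2) // concat_strD ?(ltW t2) // => -[_] e.
have h1 : (str D i (2 * s)).2 < 1 by rewrite str_lt1; lra.
have h2 : 0 < (str D' (bot D j) (2 * t - 1)).2 by rewrite str_gt0; lra.
by exfalso; lra.
Qed.

Let concat_double i s j t : (i, s) <> (j, t) ->
    concat_str i s = concat_str j t ->
  [/\ s <= 2^-1, t <= 2^-1, (i, 2 * s) <> (j, 2 * t) &
    str D i (2 * s) = str D j (2 * t)] \/
  [/\ 2^-1 <= s, 2^-1 <= t, (bot D i, 2 * s - 1) <> (bot D j, 2 * t - 1) &
    str D' (bot D i) (2 * s - 1) = str D' (bot D j) (2 * t - 1)].
Proof.
move=> ne /concat_meet [|] [s2 [t2 e]]; [left|right]; split=> // -[].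
  by move=> ij st; apply: ne; congr pair => //; lra.
by move=> /perm_inj ij st; apply: ne; congr pair => //; lra.
Qed.

Fact concat_smooth i : smooth (concat_str i).
Proof.
move=> k; apply: Cn_local => t; have [t2|/ltW t2] := leP t 2^-1.
  exists (fun s => up (str D i (2 * s + 0))); last exact: concat_up.
  exact/Cn_rescale/str_smooth.
exists (fun s => down (str D' (bot D i) (2 * s + - 1))); last exact: concat_down.
exact/Cn_rescale/str_smooth.
Qed.

Fact concat_immersion i t : 'D_1 (concat_str i) t <> 0.
Proof.
have [t2|/ltW t2] := leP t 2^-1.
  by rewrite concat_derU //; apply: squash_neq0; exact: str_immersion.
by rewrite concat_derD //; apply: squash_neq0; exact: str_immersion.
Qed.

Fact concat_top i :
  exists2 e : R, 0 < e & forall t : R, t <= e -> concat_str i t = (z i, t).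
Proof.
have [e e0 he] := str_top D i; exists (Num.min (e / 2) 2^-1).
  by rewrite lt_min divr_gt0 //= invr_gt0.
move=> t; rewrite le_min => /andP[t1 t2]; rewrite concat_strU // he; last lra.
by rewrite /up /squash /=; congr pair; field.
Qed.

Fact concat_bot i : exists2 e : R, 0 < e &
  forall t : R, 1 - e <= t -> concat_str i t = (z ((bot D * bot D')%g i), t).
Proof.
have [e e0 he] := str_bot D' (bot D i); exists (Num.min (e / 2) 2^-1).
  by rewrite lt_min divr_gt0 //= invr_gt0.
move=> t t1.
have h1 : Num.min (e / 2) 2^-1 <= e / 2 by rewrite ge_min lexx.
have h2 : Num.min (e / 2) 2^-1 <= 2^-1 by rewrite ge_min lexx orbT.
rewrite concat_strD ?he; [|lra|lra].
by rewrite /down /squash /= permM; congr pair; field.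
Qed.

Fact concat_inside i t : 0 < t < 1 -> open_square (concat_str i t).
Proof.
move=> /andP[t0 t1]; have [t2|t2] := ltP t 2^-1.
  rewrite concat_strU; last exact: ltW.
  have [|h /andP[h1 h2]] := @str_inside _ _ _ D i (2 * t); first by lra.
  by split=> //=; lra.
rewrite concat_strD //; have [->|t3] := eqVneq t 2^-1.
  rewrite str_le0; last lra.
  by split; rewrite /=; [exact: z_inside D _ | lra].
have t4 : 2^-1 < t by rewrite lt_neqAle eq_sym t3.
have [|h /andP[h1 h2]] := @str_inside _ _ _ D' (bot D i) (2 * t - 1).
  by lra.
by split=> //=; lra.
Qed.

Fact concat_transverse i s j t :
  (i, s) <> (j, t) -> concat_str i s = concat_str j t ->
  det2 ('D_1 (concat_str i) s) ('D_1 (concat_str j) t) <> 0.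
Proof.
have neq2 (x : R) : x <> 0 -> 2 * x <> 0.
  by move=> x0 /eqP; rewrite mulf_eq0 pnatr_eq0 /= => /eqP.
move=> ne /(concat_double ne) [|] [s2 t2 ne' e].
  rewrite !concat_derU // det2_squash; apply: neq2.
  exact: str_transverse ne' e.
rewrite !concat_derD // det2_squash; apply: neq2.
exact: str_transverse ne' e.
Qed.

Let concat_height i t : ((concat_str i t).2 <= 2^-1) = (t <= 2^-1).
Proof.
have [t2|t2] := leP t 2^-1.
  rewrite concat_strU //.
  have h : (str D i (2 * t)).2 <= 1 by rewrite leNgt str_gt1 -leNgt; lra.
  have g : (up (str D i (2 * t))).2 <= 2^-1 by rewrite /up /squash /=; lra.
  by rewrite g.
rewrite concat_strD; last exact: ltW.
have h : 0 < (str D' (bot D i) (2 * t - 1)).2 by rewrite str_gt0; lra.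
by apply/negbTE; rewrite -ltNge /down /squash /=; lra.
Qed.

Fact concat_double_point i r j s k t :
  concat_str i r = concat_str j s -> concat_str j s = concat_str k t ->
  [\/ (i, r) = (j, s), (j, s) = (k, t) | (i, r) = (k, t)].
Proof.
move=> e1 e2.
have h1 : (r <= 2^-1) = (s <= 2^-1) by rewrite -(concat_height i) e1 concat_height.
have h2 : (s <= 2^-1) = (t <= 2^-1) by rewrite -(concat_height j) e2 concat_height.
have [r2|r2] := leP r 2^-1.
  have s2 : s <= 2^-1 by rewrite -h1.
  have t2 : t <= 2^-1 by rewrite -h2.
  move: e1 e2; rewrite !concat_strU // => /squash_inj d1 /squash_inj d2.
  have inj i' j' (x y : R) : (i', 2 * x) = (j', 2 * y) -> (i', x) = (j', y).
    by move=> [-> xy]; congr pair; lra.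
  by have [/inj|/inj|/inj] := str_double d1 d2;
    [constructor 1|constructor 2|constructor 3].
have s2 : 2^-1 < s by rewrite ltNge -h1 -ltNge.
have t2 : 2^-1 < t by rewrite ltNge -h2 -ltNge.
move: e1 e2; rewrite !concat_strD; try exact: ltW.
move=> /squash_inj d1 /squash_inj d2.
have inj i' j' (x y : R) :
    (bot D i', 2 * x - 1) = (bot D j', 2 * y - 1) -> (i', x) = (j', y).
  by move=> [/perm_inj -> xy]; congr pair; lra.
by have [/inj|/inj|/inj] := str_double d1 d2;
  [constructor 1|constructor 2|constructor 3].
Qed.

Fact concat_finite : finite_set [set p | exists i s j t,
  [/\ (i, s) <> (j, t), concat_str i s = p & concat_str j t = p]].
Proof.
apply: (@sub_finite_set _ _ (up @` _ `|` down @` _)); last first.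
  rewrite finite_setU; split; apply: finite_image.
    exact: str_finite D.
  exact: str_finite D'.
move=> p [i [s [j [t [ne e1 e2]]]]].
have [] := concat_double ne (etrans e1 (esym e2)) => -[s2 t2 ne' e]; [left|right].
  exists (str D i (2 * s)); last by rewrite -concat_strU.
  by exists i, (2 * s), j, (2 * t).
exists (str D' (bot D i) (2 * s - 1)); last by rewrite -concat_strD.
by exists (bot D i), (2 * s - 1), (bot D j), (2 * t - 1).
Qed.

Definition concat : vdiagram z := {|
  str := concat_str;
  bot := (bot D * bot D')%g;
  lab := concat_lab;
  str_smooth := concat_smooth;
  str_immersion := concat_immersion;
  str_top := concat_top;
  str_bot := concat_bot;
  str_inside := concat_inside;
  str_transverse := concat_transverse;
  str_double := concat_double_point;
  str_finite := concat_finite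
|}.

End Concatenation.

Section WeldedEquivalence.
Context {R : realType} {n : nat} {z : 'I_n -> R}.
Implicit Types (D : vdiagram z) (i j : 'I_n) (s t : R) (B : set (R * R)).

Definition double D i s j t : Prop :=
  (i, s) <> (j, t) /\ str D i s = str D j t.

Definition double_points D : set (R * R) :=
  [set p | exists i s j t, double D i s j t /\ str D i s = p].

(* The role, at a crossing, of the first of the two strings *)
Inductive role := Over | Under | Across.

(* cw tells whether the second string is clockwise from the first one in a    *)
(* drawing; both pointing downwards, the first one then goes from left to     *)
(* right.  A crossing is positive when the over-string goes from right to     *)
(* left, both strings pointing downwards.                                     *)
Definition role_of (l : crossing_label) (cw : bool) : role :=
  match l with
  | Pos => if cw then Under else Over
  | Neg => if cw then Over else Under
  | Virt => Across
  end.

(* At times s and t, the i-th and j-th strings meet at a crossing, the i-th   *)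
(* string playing the role k there.                                           *)
Definition crossing D i s j t (k : role) (cw : bool) : Prop :=
  [/\ double D i s j t,
      cw = (0 < det2 ('D_1 (str D i) s) ('D_1 (str D j) t)) &
      k = role_of (lab D (str D i s)) cw].

Definition planar_isotopic D D' : Prop :=
  exists H : R * (R * R) -> R * R,
  [/\ smooth H /\ (forall p, H (0, p) = p),
      (forall t p, ~ open_square p -> H (t, p) = p),
      (forall t, 0 <= t <= 1 -> exists g : R * R -> R * R,
        [/\ smooth g, cancel (fun p => H (t, p)) g &
            cancel g (fun p => H (t, p))]),
      (forall i, exists rho : R -> R,
        [/\ smooth rho, (forall t, 0 < 'D_1 rho t) &
            forall t, str D' i (rho t) = H (1, str D i t)]) &
      (forall p, double_points D p -> lab D' (H (1, p)) = lab D p)].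

Definition disc B : Prop :=
  exists phi psi : R * R -> R * R,
  [/\ smooth phi, smooth psi, cancel phi psi, cancel psi phi &
      B = phi @` [set p | p.1 ^+ 2 + p.2 ^+ 2 <= 1]].

(* The arc (i, a, b) is the part of the i-th string over [a, b]. *)
Definition arc : Type := 'I_n * R * R.
Definition on_arc (A : arc) i t : Prop := A.1.1 = i /\ A.1.2 <= t <= A.2.
Definition inside_arc (A : arc) i t : Prop := A.1.1 = i /\ A.1.2 < t < A.2.

(* The disc B meets D exactly in the arcs As, which are properly embedded in  *)
(* the parameter intervals (endpoints on the boundary of B).                  *)
Definition meets_disc D B (As : seq arc) : Prop :=
  (forall i t, B (str D i t) <-> exists2 A, A \in As & on_arc A i t) /\
  (forall i t, B^° (str D i t) <-> exists2 A, A \in As & inside_arc A i t).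

(* D and D' coincide outside of the disc B, which each of them meets in arcs  *)
(* over the same disjoint intervals As.                                       *)
Definition local_change D D' B (As : seq arc) : Prop :=
  [/\ disc B /\ B `<=` open_square,
      uniq As /\ {in As, forall A, A.1.2 < A.2} /\
      {in As &, forall A A', A <> A' ->
        forall i t, on_arc A i t -> on_arc A' i t -> False},
      meets_disc D B As /\ meets_disc D' B As,
      (forall i t, ~ (exists2 A, A \in As & inside_arc A i t) ->
         str D i t = str D' i t) &
      forall p, ~ B p -> lab D p = lab D' p].

Definition arc_crossing D (A : arc) s (A' : arc) t (k : role) (cw : bool) :
    Prop :=
  [/\ on_arc A A.1.1 s, on_arc A' A'.1.1 t & crossing D A.1.1 s A'.1.1 t k cw].

(* In the moves below, the strings are arcs of a disc determined, up to       *)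
(* isotopy of the disc, by the stated incidences; the direction cw of a       *)
(* crossing is recorded to keep track of classical signs.                     *)

(* A kink is created on the arc A. *)
Definition kink (k : role) D D' : Prop :=
  exists B A s t cw,
  [/\ local_change D D' B [:: A],
      double_points D `&` B = set0,
      arc_crossing D' A s A t k cw &
      double_points D' `&` B = [set str D' A.1.1 s]].

(* The arc A0 is pushed across the arc A1; the two crossings of the resulting *)
(* bigon have opposite directions.                                            *)
Definition bigon (k : role) D D' : Prop :=
  exists B A0 A1 s t s' t' cw,
  [/\ local_change D D' B [:: A0; A1],
      double_points D `&` B = set0,
      arc_crossing D' A0 s A1 t k cw,
      arc_crossing D' A0 s' A1 t' k (~~ cw) &
      double_points D' `&` B = [set str D' A0.1.1 s; str D' A0.1.1 s']].

(* Three arcs that meet pairwise once; A0 has role k at its crossings with A1 *)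
(* (time s01 of A0, s10 of A1) and with A2, and A1 has role k' at its         *)
(* crossing with A2.                                                          *)
Definition three_arcs (k k' : role) D B (A0 A1 A2 : arc)
    (s01 s10 s02 s20 s12 s21 : R) (c01 c02 c12 : bool) : Prop :=
  [/\ arc_crossing D A0 s01 A1 s10 k c01,
      arc_crossing D A0 s02 A2 s20 k c02,
      arc_crossing D A1 s12 A2 s21 k' c12 &
      double_points D `&` B =
        [set str D A0.1.1 s01; str D A0.1.1 s02; str D A1.1.1 s12]].

(* The arc A0 moves across the crossing of A1 and A2, which reverses the      *)
(* order of the crossings along each of the three arcs.                       *)
Definition triangle (k k' : role) D D' : Prop :=
  exists B A0 A1 A2 s01 s10 s02 s20 s12 s21 t01 t10 t02 t20 t12 t21 c01 c02 c12,
  [/\ local_change D D' B [:: A0; A1; A2],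
      three_arcs k k' D B A0 A1 A2 s01 s10 s02 s20 s12 s21 c01 c02 c12,
      three_arcs k k' D' B A0 A1 A2 t01 t10 t02 t20 t12 t21 c01 c02 c12 &
      [/\ (s01 < s02) = (t02 < t01), (s10 < s12) = (t12 < t10) &
          (s20 < s21) = (t21 < t20)]].

Inductive welded_move D D' : Prop :=
| move_isotopy of planar_isotopic D D'
| move_R1 of kink Over D D'
| move_R2 of bigon Over D D'
| move_R3 of triangle Over Over D D'
| move_VR1 of kink Across D D'
| move_VR2 of bigon Across D D'
| move_VR3 of triangle Across Across D D'
| move_mixed of triangle Across Over D D'
| move_OC of triangle Over Across D D'.

(* Two diagrams represent the same welded string link. *)
Inductive welded_equiv : vdiagram z -> vdiagram z -> Prop :=
| welded_step D D' : welded_move D D' -> welded_equiv D D'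
| welded_refl D : welded_equiv D D
| welded_sym D D' : welded_equiv D D' -> welded_equiv D' D
| welded_trans D D' D'' :
    welded_equiv D D' -> welded_equiv D' D'' -> welded_equiv D D''.

Lemma local_change_bot D D' B As : local_change D D' B As -> bot D =1 bot D'.
Proof.
move=> [[_ Bsq] _ [[_ DB] _] eqD _] i; apply: (z_inj D).
have two (E : vdiagram z) : str E i 2 = (z (bot E i), 2).
  by rewrite str_ge1 // ler1n.
have : str D i 2 = str D' i 2.
  apply: eqD => /DB /interior_subset /Bsq; rewrite two => -[_] /= /andP[_].
  by rewrite ltrn1.
by rewrite !two => -[].
Qed.

Lemma isotopic_bot D D' : planar_isotopic D D' -> bot D =1 bot D'.
Proof.
move=> [H [_ Hout _ rho _]] i; apply: (z_inj D).
have [r [_ _ /(_ 1)]] := rho i.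
rewrite (str_ge1 D) // Hout => [e|[_] /=]; last by rewrite ltxx andbF.
have r1 : r 1 = 1.
  by apply/eqP; rewrite eq_le !leNgt -(str_lt1 D' i) -(str_gt1 D' i) e /= ltxx.
by move: e; rewrite r1 str_ge1 // => -[].
Qed.

Lemma kink_bot k D D' : kink k D D' -> bot D =1 bot D'.
Proof. by move=> [B [A [s [t [cw [/local_change_bot]]]]]]. Qed.

Lemma bigon_bot k D D' : bigon k D D' -> bot D =1 bot D'.
Proof.
by move=> [B [A0 [A1 [s [t [s' [t' [cw [/local_change_bot]]]]]]]]].
Qed.

Lemma triangle_bot k k' D D' : triangle k k' D D' -> bot D =1 bot D'.
Proof.
move=> [B [A0 [A1 [A2 [s01 [s10 [s02 [s20 [s12 [s21]]]]]]]]]].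
by move=> [t01 [t10 [t02 [t20 [t12 [t21 [c01 [c02 [c12 [/local_change_bot]]]]]]]]]].
Qed.

(* Hence the permutation of the endpoints depends only on the welded string   *)
(* link.                                                                      *)
Lemma welded_bot D D' : welded_equiv D D' -> bot D = bot D'.
Proof.
elim=> {D D'} [D D' m|//|D D' _ //|D D' D'' _ -> _ -> //]; apply/permP.
case: m => [/isotopic_bot //| | | | | | | | ];
  by [exact: kink_bot | exact: bigon_bot | exact: triangle_bot].
Qed.

End WeldedEquivalence.

Section LambdaTilde.
Variable n : nat.

(* The free abelian group on u_i, v_i and alpha_i, written additively *)
Definition Lam : Type := {ffun 'I_n + 'I_n + 'I_n -> int}.
HB.instance Definition _ := GRing.Zmodule.on Lam.

Definition lam_gen (g : 'I_n + 'I_n + 'I_n) : Lam := [ffun h => (h == g)%:R].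
Definition lam_u i : Lam := lam_gen (inl (inl i)).
Definition lam_v i : Lam := lam_gen (inl (inr i)).
Definition lam_a i : Lam := lam_gen (inr i).

(* The endomorphism of Lam, and of its group ring, that permutes the indices  *)
Definition lam_perm (tau : {perm 'I_n}) (w : Lam) : Lam :=
  \sum_i (lam_u (tau i) *~ w (inl (inl i)) + lam_v (tau i) *~ w (inl (inr i)) +
          lam_a (tau i) *~ w (inr i)).

Definition zlam_perm (tau : {perm 'I_n}) : zgring Lam -> zgring Lam :=
  zext (fun w => zbase (lam_perm tau w)).

End LambdaTilde.

Section TYM.
Context {R : realType} {n : nat} {z : 'I_n -> R}.
Variable D : vdiagram z.
Implicit Types (i j : 'I_n) (s t : R).

(* The string ending at z_j * {1} *)
Definition tau : {perm 'I_n} := ((bot D)^-1)%g.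

Definition crossing_times i : set R :=
  [set s | exists j t, double D i s j t].

Definition crossing_number i : nat := #|` fset_set (crossing_times i)|.

(* The pair of i and m is the m-th edge of the i-th string, counted from 0.   *)
Definition edge : Type := {i : 'I_n & 'I_(crossing_number i).+1}.
HB.instance Definition _ := Choice.on edge.

Definition mk_edge i (m : 'I_(crossing_number i).+1) : edge := Tagged _ m.

(* The edges along which the i-th string enters and leaves a crossing at time *)
(* s: their numbers are the numbers of earlier crossings.                     *)
Definition edge_in i s : edge := @mk_edge i
  (inord #|` fset_set (crossing_times i `&` [set r | r < s])|).
Definition edge_out i s : edge := @mk_edge i
  (inord #|` fset_set (crossing_times i `&` [set r | r <= s])|).

Definition top_edge i : edge := @mk_edge i ord0.
Definition bottom_edge j : edge := @mk_edge (tau j) ord_max.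

Inductive wK_rel : word (Lam n) edge -> word (Lam n) edge -> Prop :=
| wK_under i s j t cw : crossing D i s j t Under cw ->
    wK_rel [:: (edge_out i s, 0, false)]
      [:: (edge_in i s, lam_u j *~ label_sign (lab D (str D i s)), false)]
| wK_over i s j t cw : crossing D i s j t Over cw ->
    wK_rel [:: (edge_out i s, 0, false)]
      [:: (edge_in i s, lam_v j *~ label_sign (lab D (str D i s)), false)]
| wK_across_right i s j t : crossing D i s j t Across true ->
    wK_rel [:: (edge_out i s, 0, false)] [:: (edge_in i s, - lam_a j, false)]
| wK_across_left i s j t : crossing D i s j t Across false ->
    wK_rel [:: (edge_out i s, 0, false)] [:: (edge_in i s, lam_a j, false)].

Definition wK : actGroupType (Lam n) := presented wK_rel.

(* w is the family of exponents of the reduced presentation of wK. *)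
Definition wK_exponents (w : 'I_n -> Lam n) : Prop :=
  forall j, pgen wK_rel (bottom_edge j) =
            gact (pgen wK_rel (top_edge (tau j)) : wK) (w j).

Definition self_crossings i : set (R * R) :=
  [set p | exists s t, double D i s i t /\ str D i s = p].

Definition self_sign j : int :=
  \sum_(p \in self_crossings (tau j)) label_sign (lab D p).

(* The generators inl j and inr j are a_j and x_j. *)
Inductive wKt_rel (w : 'I_n -> Lam n) :
    word (Lam n) ('I_n + 'I_n)%type -> word (Lam n) ('I_n + 'I_n)%type -> Prop :=
| wKt_relI j : wKt_rel w [:: (inr j, 0, false)]
    [:: (inl (tau j),
         w j + (lam_u (tau j) + lam_v (tau j)) *~ (- self_sign j), false)].

Definition wKt (w : 'I_n -> Lam n) : actGroupType (Lam n) :=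
  presented (wKt_rel w).

Definition wKt_a w i : abel (wKt w) :=
  abel_pi (pgen (wKt_rel w) (inl i) : wKt w).
Definition wKt_x w i : abel (wKt w) :=
  abel_pi (pgen (wKt_rel w) (inr i) : wKt w).

End TYM.

Section ChangeOfBasis.
Context {A : comNzRingType} {V : lmodType A} {n : nat}.

Definition is_basis (e : 'I_n -> V) : Prop :=
  forall v, exists! c : 'I_n -> A, v = \sum_i c i *: e i.

(* M is the matrix with S M = T, for ordered bases S and T. *)
Definition change_of_basis (S T : 'I_n -> V) (M : 'M[A]_n) : Prop :=
  [/\ is_basis S, is_basis T & forall j, T j = \sum_i M i j *: S i].

Definition in_GL (M : 'M[A]_n) : Prop :=
  exists N, M *m N = 1%:M /\ N *m M = 1%:M.
End ChangeOfBasis.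

Section Matrix.
Context {R : realType} {n : nat} {z : 'I_n -> R}.

Definition is_wTYM (D : vdiagram z) (M : 'M[zgring (Lam n)]_n) : Prop :=
  exists2 w, wK_exponents D w &
    change_of_basis (@wKt_a _ _ _ D w) (@wKt_x _ _ _ D w) M.

Definition wTYM (D : vdiagram z) : 'M[zgring (Lam n)]_n :=
  xget 0 [set M | is_wTYM D M].

End Matrix.

(* Main.v *)
(* Evaluating words of wK_n in Z[Lam] by the sum of the weights met along a   *)
(* string identifies the exponent w_j with the total weight of the string     *)
(* ending at j.  A self-crossing of string i contributes (u_i v_i)^sign, so   *)
(* the normalization leaves exactly the weights of the crossings with other   *)
(* strings, and the matrix is monomial with these sums as entries.  Each sum  *)
(* runs over the double points: a kink only creates a self-crossing, the two  *)
(* crossings of a bigon cancel, a triangle keeps the strings, roles and       *)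
(* directions of its crossings, and an isotopy has positive Jacobian, since   *)
(* the Jacobian never vanishes along the isotopy and is 1 at time 0.          *)

From HB Require Import structures.
From mathcomp Require Import all_boot all_order all_algebra perm finmap.
From mathcomp Require Import all_classical all_reals topology normedtype derive.
From mathcomp Require Import ring lra.
Require Import Defs.

Set Implicit Arguments.
Unset Strict Implicit.
Unset Printing Implicit Defensive.

Import Order.TTheory GRing.Theory Num.Theory numFieldNormedType.Exports.

Local Open Scope ring_scope.
Local Open Scope classical_set_scope.

(** Along a string each edge is a translate of the previous one, so every edge is a translate of the
    top edge. The exponent at [j] is therefore the sum of the weights met by the string ending
    there. It is unique because the group evaluates in the group ring with edges sent to partial
    sums ([wK_exponentsE]). The two passages of a self-crossing contribute together its sign times
    [lam_u i + lam_v i], or cancel if it is virtual. The normalization thus leaves [mixed_sum], the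
    total weight of the crossings with other strings ([lam_weight_sum]). The reduced group makes
    each [x_j] a translate of one [a_i], so its abelianization is free on the [a_i] and the matrix
    is the monomial matrix [TYM_mx] ([is_wTYME]).

    Invariance then concerns only the permutation of the endpoints and [mixed_sum]. Rewritten over
    double points ([string_sum_points]), this sum can be compared inside and outside the disc of a
    local move ([local_change_point_sum]). Isotopies preserve it because their Jacobian is positive
    ([isotopic_point_sum]).

    The double points of a concatenation are those of the two halves, and string [i] of the lower
    half continues string [tau D i]. So the sums add after renaming indices ([concat_mixed_sum]),
    and multiplying monomial matrices gives the product formula ([concat_TYM_mx]). *)

Lemma zbase_inj (G : zmodType) : injective (@zbase G).
Proof.
move=> k l /(congr1 (fun f => zcoef f k)); rewrite !zcoef_base eqxx.
by case: eqP.
Qed.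

(** * Linear evaluation of presented groups and of their abelianizations *)

Section WordValue.
Variables (A : zmodType) (X : choiceType) (V : lmodType (zgring A)).
Variable f : X -> V.
Implicit Types (v w : word A X).

(** Words are read additively, translation by [a] becoming multiplication by [zbase a]. Values of
    the generators that respect the relations thus extend to a linear map on the abelianization. *)
Definition word_val w : V := \sum_(l <- w) (-1) ^+ l.2 *: (zbase l.1.2 *: f l.1.1).

Lemma word_val_cat v w : word_val (v ++ w) = word_val v + word_val w.
Proof. exact: big_cat. Qed.

Lemma word_val1 l :
  word_val [:: l] = (-1) ^+ l.2 *: (zbase l.1.2 *: f l.1.1).
Proof. exact: big_seq1. Qed.

Lemma word_val_letter x a : word_val [:: (x, a, false)] = zbase a *: f x.
Proof. by rewrite word_val1 scale1r. Qed.

Lemma word_val_act w a : word_val (word_act w a) = zbase a *: word_val w.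
Proof.
rewrite /word_val /word_act big_map scaler_sumr; apply: eq_bigr => l _ /=.
by rewrite zbaseD !scalerA; congr (_ *: _); ring.
Qed.

Lemma word_val_inv w : word_val (word_inv w) = - word_val w.
Proof.
elim: w => [|[[x a] b] w IH]; first by rewrite /word_val !big_nil oppr0.
rewrite -cat1s word_inv_cat !word_val_cat IH !word_val1 /= addrC opprD.
by congr (_ + _); case: b; rewrite /= expr0 expr1 scaleN1r scale1r ?opprK.
Qed.

Variable rel : word A X -> word A X -> Prop.
Hypothesis fP : forall v w, rel v w -> word_val v = word_val w.

Lemma word_val_cong v w : word_cong rel v w -> word_val v = word_val w.
Proof.
elim=> {v w} //.
- by move=> v w w' _ -> _ ->.
- by move=> v v' w w' _ e _ e'; rewrite !word_val_cat e e'.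
- move=> x a b; rewrite -cat1s word_val_cat !word_val1 /word_val big_nil /=.
  by rewrite -scalerDl; case: b; rewrite expr0 expr1 ?addNr ?subrr scale0r.
- by move=> v w a /fP e; rewrite !word_val_act e.
Qed.

End WordValue.

Section PresentedValue.
Variables (A : zmodType) (X : choiceType) (V : lmodType (zgring A)).
Variables (f : X -> V) (rel : word A X -> word A X -> Prop).
Hypothesis fP : forall v w, rel v w -> word_val f v = word_val f w.

Definition presented_val (g : presented rel) : V := word_val f (prepr g).

Lemma presented_val_class w : presented_val (pclass rel w) = word_val f w.
Proof. exact: word_val_cong fP _ _ (prepr_cong rel w). Qed.

Lemma presented_val_gen x : presented_val (pgen rel x) = f x.
Proof. by rewrite presented_val_class word_val_letter scale1r. Qed.

Lemma presented_val1 : presented_val 1%g = 0.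
Proof. by rewrite presented_val_class /word_val big_nil. Qed.

Lemma presented_valM g h :
  presented_val (g * h)%g = presented_val g + presented_val h.
Proof. by rewrite -word_val_cat -presented_val_class. Qed.

Lemma presented_valV g : presented_val g^-1%g = - presented_val g.
Proof. by rewrite -word_val_inv -presented_val_class. Qed.

Lemma presented_val_gact g a :
  presented_val (gact g a) = zbase a *: presented_val g.
Proof. by rewrite -word_val_act -presented_val_class. Qed.

Lemma presented_val_derived (g : presented rel) :
  derived g -> presented_val g = 0.
Proof.
elim=> {g} [|g h _ eg _ eh|g _ eg|g h].
- exact: presented_val1.
- by rewrite presented_valM eg eh addr0.
- by rewrite presented_valV eg oppr0.
- by rewrite !presented_valM !presented_valV addrAC subrK addNr.
Qed.

Definition abel_val (m : abel (presented rel)) : V :=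
  presented_val (abel_repr m).

Lemma abel_val_pi g : abel_val (abel_pi g) = presented_val g.
Proof.
have := presented_val_derived (abel_repr_derived g).
by rewrite presented_valM presented_valV addrC => /subr0_eq ->.
Qed.

Lemma abel_valB : {morph abel_val : m m' / m - m'}.
Proof.
move=> m m'; rewrite -(abel_reprK m) -(abel_reprK m').
rewrite -[_ - _]/(abel_add _ (abel_opp _)) abel_oppE abel_addE !abel_val_pi.
by rewrite presented_valM presented_valV.
Qed.

(** Both sides are additive in [r], which reduces the claim to basis elements, where scaling is the
    group action. *)
Lemma abel_valZ r m : abel_val (r *: m) = r *: abel_val m.
Proof.
pose vr := fun x : V => fun s : zgring A => s *: x.
have vrB x : {morph vr x : s t / s - t} by move=> s t; exact: scalerBl.
pose vrA x : {additive zgring A -> V} :=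
  HB.pack (vr x) (GRing.isZmodMorphism.Build _ _ (vr x) (vrB x)).
pose l s := abel_val (s *: m).
have lB : {morph l : s t / s - t} by move=> s t; rewrite /l scalerBl abel_valB.
pose lA : {additive zgring A -> V} :=
  HB.pack l (GRing.isZmodMorphism.Build _ _ l lB).
apply: (zext_ext (phi := lA) (psi := vrA (abel_val m))) => k /=.
rewrite /l /vr abel_scaleE -[m]abel_reprK abel_actE !abel_val_pi.
exact: presented_val_gact.
Qed.

End PresentedValue.

(** * Monomial matrices and changes of basis *)

Section MonomialBasis.
Variables (A : zmodType) (V : lmodType (zgring A)) (n : nat).
Variables (tau : {perm 'I_n}) (E : 'I_n -> A).

Definition monomial_mx : 'M[zgring A]_n :=
  \matrix_(i, j) ((i == tau j)%:R * zbase (E j)).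

Lemma zbaseNl k : zbase (- k) * zbase k = 1 :> zgring A.
Proof. by rewrite -zbaseD addNr zbase0. Qed.

Lemma zbaseNr k : zbase k * zbase (- k) = 1 :> zgring A.
Proof. by rewrite -zbaseD subrr zbase0. Qed.

Lemma in_GL_monomial_mx : in_GL monomial_mx.
Proof.
(* The transpose, with each unit [zbase k] replaced by its inverse [zbase (- k)]. *)
exists (\matrix_(i, j) ((tau i == j)%:R * zbase (- E i))).
split; apply/matrixP => i j; rewrite !mxE.
  rewrite (bigD1 (tau^-1 i)%g) //= big1 => [|k].
    rewrite addr0 !mxE permKV eqxx mul1r mulrCA zbaseNr mulr1.
    by rewrite eq_sym.
  rewrite !mxE; have [->|] := eqVneq i (tau k); first by rewrite permK eqxx.
  by rewrite !mul0r.
rewrite (bigD1 (tau i)) //= big1 => [|k /negPf nk].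
  rewrite addr0 !mxE eqxx mul1r mulrCA.
  have [/perm_inj ->|ne] := eqVneq (tau i) (tau j).
    by rewrite zbaseNl eqxx mulr1.
  by rewrite mul0r (inj_eq perm_inj) in ne *; rewrite (negPf ne).
by rewrite !mxE eq_sym nk !mul0r.
Qed.

Lemma is_basis_monomial (e : 'I_n -> V) :
  is_basis e -> is_basis (fun j => zbase (E j) *: e (tau j)).
Proof.
move=> be v; have [c [ec uc]] := be v.
exists (fun j => c (tau j) * zbase (- E j)); split.
  rewrite ec (reindex_inj (@perm_inj _ tau)); apply: eq_bigr => j _.
  by rewrite scalerA -mulrA zbaseNl mulr1.
move=> c' ec'; apply/funext => j.
have -> : c = fun i => c' ((tau^-1)%g i) * zbase (E ((tau^-1)%g i)).
  apply: uc; rewrite ec' [RHS](reindex_inj (@perm_inj _ tau)).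
  by apply: eq_bigr => k _; rewrite permK scalerA.
by rewrite permK -mulrA zbaseNr mulr1.
Qed.

Lemma change_of_basis_monomial (e : 'I_n -> V) M :
  is_basis e ->
  change_of_basis e (fun j => zbase (E j) *: e (tau j)) M <-> M = monomial_mx.
Proof.
move=> be.
have eM j : zbase (E j) *: e (tau j) = \sum_i monomial_mx i j *: e i.
  rewrite (bigD1 (tau j)) //= mxE eqxx mul1r big1 ?addr0 // => i /negPf ni.
  by rewrite mxE ni mul0r scale0r.
split=> [[_ _ eT]|->]; last by split=> //; exact: is_basis_monomial.
apply/matrixP => i j; have [c [_ uc]] := be (zbase (E j) *: e (tau j)).
have h1 := uc (M^~ j) (eT j); have h2 := uc (monomial_mx^~ j) (eM j).
by have /(congr1 (fun f => f i)) := etrans (esym h1) h2.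
Qed.

(** The linear map [phi] reads off coordinates, which gives uniqueness; only spanning remains as an
    assumption. *)
Lemma is_basis_delta (e : 'I_n -> V) (phi : V -> 'rV[zgring A]_n) :
  {morph phi : u v / u - v} ->
  (forall r v, phi (r *: v) = r *: phi v) ->
  (forall i, phi (e i) = delta_mx 0 i) ->
  (forall v, exists c : 'I_n -> zgring A, v = \sum_i c i *: e i) -> is_basis e.
Proof.
move=> phiB phiZ phie sp v.
pose phiA : {additive V -> 'rV[zgring A]_n} :=
  HB.pack phi (GRing.isZmodMorphism.Build _ _ phi phiB).
have [c ec] := sp v; exists c; split=> // c' ec'.
have coord (d : 'I_n -> zgring A) i : phi (\sum_i d i *: e i) 0 i = d i.
  rewrite -[phi]/(phiA : _ -> _) (raddf_sum phiA) /= summxE (bigD1 i) //=.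
  rewrite phiZ phie !mxE !eqxx mulr1.
  rewrite big1 ?addr0 // => k nk; rewrite phiZ phie !mxE eqxx eq_sym.
  by rewrite (negPf nk) mulr0.
by apply/funext => i; rewrite -(coord c) -ec ec' coord.
Qed.

End MonomialBasis.

(** * Presentations where each [x_j] is a translate of some [a_i] *)

Section EliminatedPresentation.
Variables (A : zmodType) (n : nat) (tau : {perm 'I_n}) (E : 'I_n -> A).
Variable rel : word A ('I_n + 'I_n)%type -> word A ('I_n + 'I_n)%type -> Prop.
Hypothesis relE : forall v w, rel v w <->
  exists j, v = [:: (inr j, 0, false)] /\ w = [:: (inl (tau j), E j, false)].

Let a i : abel (presented rel) := abel_pi (pgen rel (inl i)).
Let x i : abel (presented rel) := abel_pi (pgen rel (inr i)).

Let abel_piM (g h : presented rel) : abel_pi (g * h)%g = abel_pi g + abel_pi h.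
Proof. by rewrite -abel_addE. Qed.

Let abel_piV (g : presented rel) : abel_pi g^-1%g = - abel_pi g.
Proof. by rewrite -abel_oppE. Qed.

Let pclass_letter y b : pclass rel [:: (y, b, false)] = gact (pgen rel y) b.
Proof. by rewrite [RHS]pactE /= add0r. Qed.

Let abel_pi_letter y b (s : bool) :
  abel_pi (pclass rel [:: (y, b, s)]) =
  (-1) ^+ s *: (zbase b *: abel_pi (pgen rel y)).
Proof.
rewrite abel_scaleE abel_actE -pclass_letter.
case: s; rewrite ?expr0 ?expr1 ?scale1r ?scaleN1r // -abel_piV.
congr abel_pi; change (pclass rel [:: (y, b, true)] =
  pinv (pclass rel [:: (y, b, false)])).
by rewrite pinvE.
Qed.

Lemma eliminated_generator j : x j = zbase (E j) *: a (tau j).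
Proof.
rewrite abel_scaleE abel_actE -pclass_letter; congr abel_pi.
apply/pclassP; have r : rel [:: (inr j, 0, false)] [:: (inl (tau j), E j, false)].
  by apply/relE; exists j.
by have := cong_rel 0 r; rewrite !word_act0.
Qed.

(** Sending [a_i] to the standard basis and [x_j] to the value dictated by its relation defines the
    coordinate map. Spanning goes by induction on a representing word, each [x_j] being
    eliminated. *)
Lemma eliminated_basis : is_basis a.
Proof.
pose f (y : 'I_n + 'I_n) : 'rV[zgring A]_n :=
  match y with
  | inl i => delta_mx 0 i
  | inr j => zbase (E j) *: delta_mx 0 (tau j)
  end.
have fP v w : rel v w -> word_val f v = word_val f w.
  move=> /relE [j [-> ->]]; rewrite !word_val_letter.
  exact: (scale1r (f (inr j))).
apply: (@is_basis_delta _ _ _ _ (abel_val f (rel := rel))).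
- exact: abel_valB.
- exact: abel_valZ.
- by move=> i /=; rewrite abel_val_pi // presented_val_gen.
move=> v; rewrite -(abel_reprK v) -(preprK (abel_repr v)).
elim: (prepr _) => [|[[y b] s] w [c ec]].
  exists (fun=> 0); rewrite big1 // => i _; exact: scale0r.
rewrite -cat1s -pmulE -/(_ * _)%g abel_piM ec abel_pi_letter.
have [d ->] : exists d : 'I_n -> zgring A, abel_pi (pgen rel y) = \sum_i d i *: a i.
  have single k r : r *: a k = \sum_i (i == k)%:R * r *: a i.
    rewrite (bigD1 k) //= eqxx mul1r big1 ?addr0 // => i /negPf ->.
    by rewrite mul0r scale0r.
  case: y => k.
    by exists (fun i => (i == k)%:R * 1); rewrite -single scale1r.
  by exists (fun i => (i == tau k)%:R * zbase (E k)); 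
  rewrite -single -eliminated_generator.
exists (fun i => (-1) ^+ s * (zbase b * d i) + c i).
have scale_comb r (h : 'I_n -> zgring A) :
    r *: (\sum_i h i *: a i) = \sum_i (r * h i) *: a i.
  by rewrite [LHS]scaler_sumr; apply: eq_bigr => i _; rewrite [LHS]scalerA.
rewrite !scale_comb -big_split; apply: eq_bigr => i _.
by rewrite [RHS]scalerDl.
Qed.

Lemma change_of_basis_eliminated M :
  change_of_basis a x M <-> M = monomial_mx tau E.
Proof.
have -> : x = fun j => zbase (E j) *: a (tau j).
  by apply/funext => j; exact: eliminated_generator.
exact: change_of_basis_monomial eliminated_basis.
Qed.

End EliminatedPresentation.

(** * Crossings, and sums over passages or over double points *)

Section Crossings.
Context {R : realType} {n : nat} {z : 'I_n -> R}.
Implicit Types (D : vdiagram z) (i j l : 'I_n) (s t : R) (p : R * R).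

Definition opp_role (k : role) : role :=
  match k with Over => Under | Under => Over | Across => Across end.

Lemma det2C (u v : R * R) : det2 v u = - det2 u v.
Proof. by rewrite /det2; ring. Qed.

Lemma double_sym D i s j t : double D i s j t -> double D j t i s.
Proof. by move=> [ne e]; split=> // -[ij st]; apply: ne; rewrite ij st. Qed.

Lemma double_crossing D i s j t : double D i s j t ->
  crossing D i s j t (role_of (lab D (str D i s))
    (0 < det2 ('D_1 (str D i) s) ('D_1 (str D j) t)))
    (0 < det2 ('D_1 (str D i) s) ('D_1 (str D j) t)).
Proof. by []. Qed.

Lemma crossing_sym D i s j t k cw :
  crossing D i s j t k cw -> crossing D j t i s (opp_role k) (~~ cw).
Proof.
move=> [d -> ->]; have [ne e] := d; split; first exact: double_sym.
  have flip (x : R) : x <> 0 -> ~~ (0 < x) = (0 < - x).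
    by move=> /eqP x0; rewrite oppr_gt0 -leNgt le_eqVlt (negPf x0).
  by rewrite (det2C ('D_1 (str D i) s)); exact: flip (str_transverse ne e).
by rewrite -e; case: lab; case: (0 < _).
Qed.

(* The three passages meeting at a point cannot be distinct. *)
Lemma double_partner D i s j t j' t' :
  double D i s j t -> double D i s j' t' -> (j, t) = (j', t').
Proof.
move=> [ne e] [ne' e'].
have e2 : str D j t = str D j' t' by rewrite -e -e'.
by have [/ne|//|/ne'] := str_double e e2.
Qed.

Lemma crossing_inj D i s j t k cw j' t' k' cw' :
  crossing D i s j t k cw -> crossing D i s j' t' k' cw' ->
  [/\ j = j', t = t', k = k' & cw = cw'].
Proof.
move=> [d ec ek] [d' ec' ek']; have [ej et] := double_partner d d'.
subst j' t'; have ecw : cw = cw' := etrans ec (esym ec').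
by rewrite ek ek' ecw; split.
Qed.

Lemma double_passage D i s j t l r : double D i s j t ->
  str D l r = str D i s -> (l, r) = (i, s) \/ (l, r) = (j, t).
Proof.
move=> [ne e] e'.
by have [->|/ne|->] := str_double e' e; [left| |right].
Qed.

Lemma finite_double_points D : finite_set (double_points D).
Proof.
apply: sub_finite_set (str_finite D).
move=> p [i [s [j [t [[ne e] ep]]]]].
by exists i, s, j, t; split=> //; rewrite -e.
Qed.

(** There are finitely many double points, and each is visited at no more than two parameters. *)
Lemma finite_crossing_times D i : finite_set (crossing_times D i).
Proof.
apply: (@sub_finite_set _ _
  (\bigcup_(p in double_points D) [set s | str D i s = p])).
  by move=> s [j [t d]]; exists (str D i s) => //; exists i, s, j, t.
apply: bigcup_finite; first exact: finite_double_points.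
move=> p [j [s [k [t [d <-]]]]].
apply: (@sub_finite_set _ _ [set s; t]); last exact: finite_set2.
by move=> r /= /(double_passage d) [[_ ->]|[_ ->]]; [left|right].
Qed.

Section WeightedSums.
Variables (V : zmodType) (c : 'I_n -> role -> bool -> 'I_n -> V).

(* c i k cw j is the contribution to string i of a crossing with string j,    *)
(* where string i has role k.                                                 *)
Definition passage_weight D i s : V :=
  xget 0 [set x | exists j t k cw,
    crossing D i s j t k cw /\ x = c i k cw j].

Lemma passage_weightE D i s j t k cw :
  crossing D i s j t k cw -> passage_weight D i s = c i k cw j.
Proof.
move=> cr; rewrite /passage_weight; case: xgetP => [x _|/(_ (c i k cw j)) []].
  by move=> [j' [t' [k' [cw' [cr' ->]]]]]; have [-> _ -> ->] := crossing_inj cr cr'.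
by exists j, t, k, cw.
Qed.

Definition string_sum D i : V :=
  \sum_(s <- fset_set (crossing_times D i)) passage_weight D i s.

(** Both passages are credited to their own string, so a self-crossing counts twice. By
    [crossing_weight_sym] the order in which the passages are listed does not matter. *)
Definition crossing_weight l i j k cw : V :=
  c i k cw j *+ (l == i) + c j (opp_role k) (~~ cw) i *+ (l == j).

Lemma crossing_weight_sym l i j k cw :
  crossing_weight l j i (opp_role k) (~~ cw) = crossing_weight l i j k cw.
Proof. by rewrite /crossing_weight addrC negbK; case: k. Qed.

Definition point_weight D l p : V :=
  xget 0 [set x | exists i s j t k cw,
    [/\ crossing D i s j t k cw, str D i s = p & x = crossing_weight l i j k cw]].

Lemma point_weightE D l i s j t k cw : crossing D i s j t k cw ->
  point_weight D l (str D i s) = crossing_weight l i j k cw.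
Proof.
move=> cr; rewrite /point_weight.
case: xgetP => [x _|/(_ (crossing_weight l i j k cw)) []]; last first.
  by exists i, s, j, t, k, cw.
move=> [i' [s' [j' [t' [k' [cw' [cr' e ->]]]]]]].
have [d _ _] := cr; have [[ei es]|[ei es]] := double_passage d e.
  by move: cr'; rewrite ei es => /(crossing_inj cr) [-> _ -> ->].
move: cr'; rewrite ei es => /(crossing_inj (crossing_sym cr)) [<- _ <- <-].
exact: crossing_weight_sym.
Qed.

Definition point_sum D l : V :=
  \sum_(p <- fset_set (double_points D)) point_weight D l p.

(** Double counting: group the crossing times by the point visited. Exactly two passages meet at a
    double point, and those lying on string [i] give the nonzero terms of its [crossing_weight]. *)
Lemma string_sum_points D i : string_sum D i = point_sum D i.
Proof.
set T := fset_set (crossing_times D i); set P := fset_set (double_points D).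
have memT s : s \in T = `[< crossing_times D i s >].
  by rewrite in_fset_set ?inE //; exact: finite_crossing_times.
have memP p : p \in P = `[< double_points D p >].
  by rewrite in_fset_set ?inE //; exact: finite_double_points.
have e s : s \in T -> passage_weight D i s =
    \sum_(p <- P | str D i s == p) passage_weight D i s.
  rewrite memT => /asboolP [j [t d]].
  rewrite -big_filter (_ : [seq _ <- _ | _] = [:: str D i s]) ?big_seq1 //.
  have -> : [seq p <- P | str D i s == p] = seq.filter (pred1 (str D i s)) P.
    by apply: eq_filter => p; rewrite /= eq_sym.
  rewrite filter_pred1_uniq ?fset_uniq // memP; apply/asboolP.
  by exists i, s, j, t.
rewrite /string_sum big_seq (eq_bigr _ e) -big_seq.
rewrite (exchange_big_dep xpredT) //=.
rewrite /point_sum [LHS]big_seq [RHS]big_seq; apply: eq_bigr => p.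
rewrite memP => /asboolP [a [s [b [t [d <-]]]]].
have cr := double_crossing d; rewrite (point_weightE i cr).
set k := role_of _ _ in cr *; set cw := 0 < _ in k cr *.
rewrite /crossing_weight -(passage_weightE cr).
rewrite -(passage_weightE (crossing_sym cr)).
(* Turns each of the two terms of the point weight into a sum over the times of string [i], so that
   both sides can be compared time by time. *)
have sel a' s' : crossing_times D a' s' -> passage_weight D a' s' *+ (i == a') =
     \sum_(r <- T | (i, r) == (a', s')) passage_weight D i r.
  move=> cs; have [ia|ia] := eqVneq i a'; last first.
    by rewrite mulr0n big1 // => r /eqP [/eqP]; rewrite (negPf ia).
  rewrite -ia mulr1n (eq_bigl (pred1 s')); last by move=> r; rewrite xpair_eqE eqxx.
  rewrite -big_filter filter_pred1_uniq ?fset_uniq ?big_seq1 // memT.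
  by apply/asboolP; rewrite ia.
rewrite !sel; [|by exists a, s; exact: double_sym|by exists b, t].
rewrite [LHS]big_mkcond [X in _ = X + _]big_mkcond [X in _ = _ + X]big_mkcond.
rewrite -big_split; apply: eq_bigr => r _ /=.
have [ne ed] := d; have [e1|e1] := eqVneq (i, r) (a, s).
  have [-> ->] := e1; rewrite eqxx.
  by have [/ne //|_] := eqVneq (a, s) (b, t); rewrite addr0.
have [e2|e2] := eqVneq (i, r) (b, t).
  by have [-> ->] := e2; rewrite ed eqxx add0r.
rewrite addr0; case: eqP => // /(double_passage d) [] /eqP.
  by rewrite (negPf e1).
by rewrite (negPf e2).
Qed.

End WeightedSums.
End Crossings.

Lemma ltn_card_fset (T : choiceType) (A B : {fset T}) x :
  {subset A <= B} -> x \in B -> x \notin A -> (#|` A| < #|` B|)%N.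
Proof.
move=> AB xB xA; have := cardfsU1 x A; rewrite xA add1n => <-.
by apply/fsubset_leq_card/fsubsetP => y; rewrite !inE => /orP[/eqP ->|/AB].
Qed.

(** * The exponents of [wK] as total weights of strings *)

Section Exponents.
Context {R : realType} {n : nat} {z : 'I_n -> R}.
Variable D : vdiagram z.
Implicit Types (i j : 'I_n) (s t : R) (k : role) (cw : bool).

(** The local moves record roles and directions instead of labels, so the sign is recovered from
    these. *)
Definition crossing_sign k cw : int :=
  match k with
  | Over => if cw then -1 else 1
  | Under => if cw then 1 else -1
  | Across => 0
  end.

Lemma label_sign_role l cw :
  label_sign l = crossing_sign (role_of l cw) cw.
Proof. by case: l; case: cw. Qed.

Lemma crossing_label_sign i s j t k cw : crossing D i s j t k cw ->
  label_sign (lab D (str D i s)) = crossing_sign k cw.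
Proof. by move=> [_ _ ->]; exact: label_sign_role. Qed.

(** The exponents in the relations [wK_rel], with the label expressed through role and direction. *)
Definition lam_weight i k cw j : Lam n :=
  match k with
  | Over => lam_v j *~ crossing_sign k cw
  | Under => lam_u j *~ crossing_sign k cw
  | Across => if cw then - lam_a j else lam_a j
  end.

Definition times_lt i s : {fset R} :=
  fset_set (crossing_times D i `&` [set r | r < s]).
Definition times_le i s : {fset R} :=
  fset_set (crossing_times D i `&` [set r | r <= s]).

Lemma mem_times i s :
  s \in fset_set (crossing_times D i) = `[< crossing_times D i s >].
Proof. by rewrite in_fset_set ?inE //; exact: finite_crossing_times. Qed.

Lemma mem_times_lt i s r :
  r \in times_lt i s = (r \in fset_set (crossing_times D i)) && (r < s).
Proof.
rewrite mem_times in_fset_set; last exact/finite_setIl/finite_crossing_times.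
apply/idP/andP => [/set_mem [h1 h2]|[/asboolP h1 h2]]; last exact: mem_set.
by split=> //; exact/asboolP.
Qed.

Lemma mem_times_le i s r :
  r \in times_le i s = (r \in fset_set (crossing_times D i)) && (r <= s).
Proof.
rewrite mem_times in_fset_set; last exact/finite_setIl/finite_crossing_times.
apply/idP/andP => [/set_mem [h1 h2]|[/asboolP h1 h2]]; last exact: mem_set.
by split=> //; exact/asboolP.
Qed.

Lemma times_leE i s : crossing_times D i s ->
  times_le i s = (s |` times_lt i s)%fset.
Proof.
move=> cs; apply/fsetP => r; rewrite !inE mem_times_le mem_times_lt le_eqVlt.
have [->|] := eqVneq r s; last by [].
by rewrite mem_times; apply/andP; split=> //; apply/asboolP.
Qed.

Lemma notin_times_lt i s : s \notin times_lt i s.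
Proof. by rewrite mem_times_lt ltxx andbF. Qed.

Lemma card_times_lt i s : crossing_times D i s ->
  (#|` times_lt i s| < crossing_number D i)%N.
Proof.
move=> cs; apply: (@ltn_card_fset _ _ _ s) (notin_times_lt i s).
  by move=> r; rewrite mem_times_lt => /andP[].
by rewrite mem_times; apply/asboolP.
Qed.

Lemma card_times_le i s : crossing_times D i s ->
  #|` times_le i s| = #|` times_lt i s|.+1.
Proof. by move=> cs; rewrite times_leE // cardfsU1 notin_times_lt. Qed.

Lemma card_times_lt_homo i s s' : crossing_times D i s -> s < s' ->
  (#|` times_lt i s| < #|` times_lt i s'|)%N.
Proof.
move=> cs ss'; apply: (@ltn_card_fset _ _ _ s) (notin_times_lt i s).
  by move=> r; rewrite !mem_times_lt => /andP[-> /lt_trans ->].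
by rewrite mem_times_lt ss' mem_times andbT; apply/asboolP.
Qed.

Lemma card_times_lt_inj i : {in crossing_times D i &,
  injective (fun s => #|` times_lt i s|)}.
Proof.
move=> s s' /set_mem cs /set_mem cs' e; apply/eqP.
by case: ltgtP => // /card_times_lt_homo => [/(_ _ cs)|/(_ _ cs')]; rewrite e ltnn.
Qed.

(** The ranks of the crossing times are distinct and smaller than their number, so every rank
    occurs. Hence each edge other than the top one leaves some crossing. *)
Lemma card_times_lt_surj i m : (m < crossing_number D i)%N ->
  exists2 s, crossing_times D i s & #|` times_lt i s| = m.
Proof.
move=> mN; set T := fset_set (crossing_times D i).
pose c := [seq #|` times_lt i s| | s <- T].
have uc : uniq c.
  rewrite map_inj_in_uniq ?fset_uniq // => s s'.
  rewrite !mem_times => /asboolP cs /asboolP cs'.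
  by apply: card_times_lt_inj; exact: mem_set.
have sub : {subset c <= iota 0 (crossing_number D i)}.
  move=> _ /mapP [s sT ->]; rewrite mem_iota /= add0n; apply: card_times_lt.
  by move: sT; rewrite mem_times => /asboolP.
have sz : (size (iota 0 (crossing_number D i)) <= size c)%N.
  by rewrite size_iota size_map.
have [_ ec] := uniq_min_size uc sub sz.
have : m \in c by rewrite ec mem_iota.
by case/mapP => s; rewrite mem_times => /asboolP cs ->; exists s.
Qed.

Definition partial_weight i m : Lam n :=
  \sum_(s <- fset_set (crossing_times D i) | (#|` times_lt i s| < m)%N)
    passage_weight lam_weight D i s.

Lemma partial_weight0 i : partial_weight i 0 = 0.
Proof. by rewrite /partial_weight big_pred0. Qed.

Lemma partial_weightS i s : crossing_times D i s ->
  partial_weight i #|` times_le i s| =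
  partial_weight i #|` times_lt i s| + passage_weight lam_weight D i s.
Proof.
move=> cs; rewrite card_times_le // /partial_weight.
have sT : s \in fset_set (crossing_times D i) by rewrite mem_times; apply/asboolP.
have e : passage_weight lam_weight D i s =
    \sum_(r <- fset_set (crossing_times D i) | r == s)
      passage_weight lam_weight D i r.
  by rewrite -big_filter filter_pred1_uniq ?fset_uniq ?big_seq1.
rewrite [in RHS]e [LHS]big_mkcond [X in _ = X + _]big_mkcond.
rewrite [X in _ = _ + X]big_mkcond -big_split /=.
rewrite [LHS]big_seq [RHS]big_seq; apply: eq_bigr => r.
rewrite mem_times => /asboolP cr; rewrite ltnS leq_eqVlt.
have [->|ne] := eqVneq r s; first by rewrite eqxx ltnn add0r.
case: eqP => [/card_times_lt_inj e'|_]; last by rewrite addr0.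
by move: ne; rewrite e' ?eqxx ?inE.
Qed.

Lemma partial_weight_all i :
  partial_weight i (crossing_number D i) = point_sum lam_weight D i.
Proof.
rewrite -string_sum_points /partial_weight /string_sum.
rewrite [LHS]big_seq_cond [RHS]big_seq; apply: eq_bigl => s.
rewrite mem_times; case: asboolP => //= cs; exact: card_times_lt.
Qed.

Lemma crossing_time i s j t k cw :
  crossing D i s j t k cw -> crossing_times D i s.
Proof. by move=> [d _ _]; exists j, t. Qed.

Lemma wK_relE v w : @wK_rel _ _ _ D v w -> exists i s, [/\ crossing_times D i s,
  v = [:: (edge_out D i s, 0, false)] &
  w = [:: (edge_in D i s, passage_weight lam_weight D i s, false)]].
Proof.
case=> [i s j t cw cr|i s j t cw cr|i s j t cr|i s j t cr]; exists i, s;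
  rewrite (passage_weightE lam_weight cr) /= ?(crossing_label_sign cr);
  split=> //; exact: crossing_time cr.
Qed.

Lemma wK_rel_passage i s : crossing_times D i s ->
  wK_rel [:: (edge_out D i s, 0, false)]
    [:: (edge_in D i s, passage_weight lam_weight D i s, false)].
Proof.
move=> [j [t d]]; have [k [cw cr]] : exists k cw, crossing D i s j t k cw.
  by do 2 eexists; exact: double_crossing d.
 rewrite (passage_weightE lam_weight cr).
case: k cr => cr; rewrite /lam_weight -?(crossing_label_sign cr).
- exact: wK_over cr.
- exact: wK_under cr.
- by case: cw cr => cr; [exact: wK_across_right cr | exact: wK_across_left cr].
Qed.

(** A test evaluation with value 1 on all top edges. It respects the relations and so detects
    exponents. *)
Let edge_weight (e : edge D) : zgring (Lam n) :=
  zbase (partial_weight (tag e) (tagged e)).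

Let edge_weightP v w : @wK_rel _ _ _ D v w ->
  word_val (V := (zgring (Lam n))^o) edge_weight v =
  word_val (V := (zgring (Lam n))^o) edge_weight w.
Proof.
move=> /wK_relE [i [s [cs -> ->]]]; rewrite !word_val_letter.
rewrite [LHS]scale1r /edge_weight /edge_in /edge_out /= -/(times_le i s) -/(times_lt i s).
have h := card_times_lt cs.
(* The ranks before and after [s] do not exceed the number of crossings, so [inord] returns them
   unchanged. *)
rewrite !inordK ?card_times_le // ?ltnS ?(ltnW h) // -card_times_le //.
by rewrite partial_weightS // zbaseD mulrC.
Qed.

(** For uniqueness, [edge_weight] turns the defining equation into an equality of two basis elements
    of the group ring. For existence, the relations are followed edge by edge from the top. *)
Lemma wK_exponentsE w :
  wK_exponents D w <-> w = fun j => point_sum lam_weight D (tau D j).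
Proof.
have unique w' : wK_exponents D w' -> w' = fun j => point_sum lam_weight D (tau D j).
  move=> ew; apply/funext => j.
  have := congr1 (presented_val (V := (zgring (Lam n))^o) edge_weight
    (rel := @wK_rel _ _ _ D)) (ew j).
  rewrite presented_val_gact // !presented_val_gen //.
  rewrite /edge_weight /= partial_weight0 partial_weight_all.
  by rewrite zbase0 => /esym; rewrite [_ *: _]mulr1 => /zbase_inj.
split; first exact: unique.
move=> -> j; rewrite -partial_weight_all.
set i := tau D j.
have step m (mN : (m < (crossing_number D i).+1)%N) :
    pgen (@wK_rel _ _ _ D) (mk_edge (Ordinal mN)) =
    gact (pgen (@wK_rel _ _ _ D) (top_edge D i) : wK D) (partial_weight i m).
  elim: m mN => [|m IH] mN.
    rewrite partial_weight0 gact0; congr pgen; congr mk_edge; exact: val_inj.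
  have [s cs em] := @card_times_lt_surj i m mN.
  have lt_m : (m < (crossing_number D i).+1)%N by exact: ltnW.
  have eout : edge_out D i s = mk_edge (Ordinal mN).
    rewrite /edge_out -/(times_le i s) card_times_le // em.
    by congr mk_edge; apply: val_inj; rewrite /= inordK.
  have ein : edge_in D i s = mk_edge (Ordinal lt_m).
    rewrite /edge_in -/(times_lt i s) em.
    by congr mk_edge; apply: val_inj; rewrite /= inordK.
  have := cong_rel 0 (wK_rel_passage cs); rewrite !word_act0 => /pclassP.
  rewrite eout ein => e.
  have := partial_weightS cs; rewrite card_times_le // em => ->.
  rewrite [LHS]e gactD -(IH lt_m) [RHS]pactE /=.
  by rewrite add0r.
by rewrite /bottom_edge -step; congr pgen; congr mk_edge; exact: val_inj.
Qed.

End Exponents.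

(** * Removal of the self-crossings and the explicit matrix *)

Section ReducedWeights.
Context {R : realType} {n : nat} {z : 'I_n -> R}.
Implicit Types (D : vdiagram z) (i j : 'I_n).

(* A self-crossing adds (u_i + v_i) * sign to the total weight of string i:   *)
(* without these, what remains is the exponent normalized by (u_i v_i)^-k_j.  *)
Definition mixed_weight i k cw j : Lam n :=
  if i == j then 0 else lam_weight i k cw j.

(** At a classical crossing one passage is over and the other under, with the same sign. At a
    virtual one the two directions are opposite, so the [lam_a i] terms cancel. *)
Lemma lam_weight_self i k cw :
  lam_weight i k cw i + lam_weight i (opp_role k) (~~ cw) i =
  (lam_u i + lam_v i) *~ crossing_sign k cw.
Proof.
case: k; rewrite /lam_weight /opp_role.
- by rewrite [RHS]mulrzDl [LHS]addrC; case: cw.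
- by rewrite [RHS]mulrzDl; case: cw.
by rewrite mulr0z; case: cw; [exact: addNr | exact: subrr].
Qed.

Lemma crossing_weight_mixed l i j k cw :
  crossing_weight lam_weight l i j k cw =
  crossing_weight mixed_weight l i j k cw +
  (lam_u l + lam_v l) *~ (if (i == l) && (j == l) then crossing_sign k cw else 0).
Proof.
rewrite /crossing_weight /mixed_weight [j == i]eq_sym.
have [->|ij] := eqVneq i j; last first.
  case: andP => [[/eqP il /eqP jl]|_]; last by rewrite mulr0z addr0.
  by rewrite il jl eqxx in ij.
rewrite !mul0rn add0r [l == j]eq_sym andbb add0r.
by case: eqP => [->|_]; rewrite ?mulr1n ?mulr0n ?mulr0z ?addr0 // lam_weight_self.
Qed.

Lemma lam_weight_sum D i : point_sum lam_weight D i =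
  point_sum mixed_weight D i + (lam_u i + lam_v i) *~
    (\sum_(p \in self_crossings D i) label_sign (lab D p)).
Proof.
have selfD : self_crossings D i `<=` double_points D.
  by move=> p [s [t [d e]]]; exists i, s, i, t.
have fdp := finite_double_points D.
rewrite -(setIidl selfD) fsbig_mkcondl (fsbig_finite _ _ fdp) /=.
rewrite mulrz_sumr /point_sum -big_split /= [LHS]big_seq [RHS]big_seq.
apply: eq_bigr => p; rewrite in_fset_set // => /set_mem.
move=> [a [s [b [t [d <-]]]]]; have cr := double_crossing d.
rewrite !(point_weightE _ _ cr) crossing_weight_mixed.
rewrite -(crossing_label_sign cr); congr (_ + _ *~ _).
(* Only two passages meet at the point, so it is a self-crossing of [i] exactly when both are on
   [i]. *)
rewrite (_ : (str D a s \in self_crossings D i) = (a == i) && (b == i)) //.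
apply/idP/andP => [/set_mem [s' [t' [d' e]]]|[/eqP ai /eqP bi]]; last first.
  by rewrite ai bi in d *; apply/mem_set; exists s, t.
have [ne e'] := d'; have e2 := etrans (esym e') e.
have [E1|E1] := double_passage d e; have [E2|E2] := double_passage d e2.
- by case: ne; rewrite E1.
- by move: E1 E2 => [-> _] [-> _].
- by move: E1 E2 => [-> _] [-> _].
- by case: ne; rewrite E1.
Qed.

Definition mixed_sum D i : Lam n := point_sum mixed_weight D i.

Definition TYM_mx D : 'M[zgring (Lam n)]_n :=
  monomial_mx (tau D) (fun j => mixed_sum D (tau D j)).

(** The exponents are forced, [self_sign] cancels the self-crossing term, and the eliminated
    presentation has a unique change of basis matrix. *)
Lemma is_wTYME D M : is_wTYM D M <-> M = TYM_mx D.
Proof.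
have relE w v v' : @wKt_rel _ _ _ D w v v' <-> exists j,
    v = [:: (inr j, 0, false)] /\
    v' = [:: (inl (tau D j), w j +
      (lam_u (tau D j) + lam_v (tau D j)) *~ (- self_sign D j), false)].
  by split=> [[j]|[j [-> ->]]]; [exists j | exact: wKt_relI].
pose w0 j := point_sum lam_weight D (tau D j).
have reduced j : w0 j + (lam_u (tau D j) + lam_v (tau D j)) *~ (- self_sign D j) =
    mixed_sum D (tau D j).
  by rewrite /w0 lam_weight_sum mulrNz addrK.
have main : change_of_basis (@wKt_a _ _ _ D w0) (@wKt_x _ _ _ D w0) M <->
    M = TYM_mx D.
  rewrite /TYM_mx -(funext reduced).
  exact: change_of_basis_eliminated (relE w0) M.
split=> [[w /wK_exponentsE -> /main //]|/main h].
by exists w0; first exact/wK_exponentsE.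
Qed.

Lemma wTYME D : wTYM D = TYM_mx D.
Proof.
rewrite /wTYM; case: xgetP => [M _ /is_wTYME //|/(_ (TYM_mx D)) []].
exact/is_wTYME.
Qed.

End ReducedWeights.

(** * Invariance under the local moves *)

Section LocalMoves.
Context {R : realType} {n : nat} {z : 'I_n -> R}.
Implicit Types (D : vdiagram z) (i j l : 'I_n) (s t : R) (B : set (R * R)).
Implicit Types (A : arc (R := R) (n := n)).

Lemma smooth_continuous (V W : normedModType R) (f : V -> W) :
  smooth f -> continuous f.
Proof. exact: (fun h => h 0%N). Qed.

(** The disc is the preimage of the closed unit disc under the continuous inverse [psi]. *)
Lemma closed_disc B : disc B -> closed B.
Proof.
move=> [phi [psi [sphi spsi phiK psiK ->]]].
have -> : phi @` [set p | p.1 ^+ 2 + p.2 ^+ 2 <= 1] =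
    psi @^-1` [set p | p.1 ^+ 2 + p.2 ^+ 2 <= 1].
  apply/seteqP; split=> [_ [p hp <-]|p hp]; rewrite /= ?phiK //.
  by exists (psi p); rewrite ?psiK.
apply: preimage_closed => [p _|]; first exact: smooth_continuous spsi p.
pose f (p : R * R) : R := p.1 ^+ 2 + p.2 ^+ 2.
apply: (@preimage_closed _ _ f [set x | x <= 1]); last exact: closed_le.
move=> p _; have c1 : (fun q : R * R => q.1) @ p --> p.1 by exact: cvg_fst.
have c2 : (fun q : R * R => q.2) @ p --> p.2 by exact: cvg_snd.
by apply: cvgD; rewrite expr2; apply: cvgM.
Qed.

Lemma local_change_sym D D' B As :
  local_change D D' B As -> local_change D' D B As.
Proof.
move=> [hB hAs [m m'] e el]; split=> //.
- by move=> i t h; rewrite e.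
- by move=> p h; rewrite el.
Qed.

(** Since the disc is closed, the diagrams coincide near any time sent outside it, so tangent
    vectors agree there as well as positions and labels. *)
Lemma local_change_crossing D D' B As i s j t k cw :
  local_change D D' B As -> crossing D i s j t k cw -> ~ B (str D i s) ->
  crossing D' i s j t k cw /\ str D' i s = str D i s.
Proof.
move=> [[/closed_disc cB _] _ [[mD _] _] eqD eqlab] [[ne e] ec ek] nB.
have agree a u : ~ B (str D a u) -> str D a u = str D' a u.
  move=> nb; apply: eqD => -[A AAs [Aa /andP[Au uA]]]; apply/nb/mD.
  by exists A => //; split=> //; rewrite !ltW.
have deriv a u : ~ B (str D a u) -> 'D_1 (str D a) u = 'D_1 (str D' a) u.
  move=> nb; apply: near_eq_derive.
  have oB : nbhs (str D a u) (~` B).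
    by apply: open_nbhs_nbhs; split=> //; exact: closed_openC.
  have h : \forall v \near u, ~ B (str D a v).
    exact: (smooth_continuous (str_smooth D a) oB).
  by apply: filterS h => v; exact: agree.
have nB' : ~ B (str D j t) by rewrite -e.
split; last by rewrite -agree.
split.
- by split=> //; rewrite -!agree.
- by rewrite -!deriv.
- by rewrite -agree // -eqlab.
Qed.

Section PointSum.
Variables (V : zmodType) (c : 'I_n -> role -> bool -> 'I_n -> V).

Definition point_sum_in B D l : V :=
  \sum_(p \in double_points D `&` B) point_weight c D l p.

Lemma local_change_point_sum D D' B As l : local_change D D' B As ->
  point_sum_in B D l = point_sum_in B D' l ->
  point_sum c D l = point_sum c D' l.
Proof.
move=> ch eB.
have split_sum E : point_sum c E l = point_sum_in B E l +
    \sum_(p \in double_points E `&` ~` B) point_weight c E l p.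
  have f := finite_double_points E.
  by rewrite /point_sum -fsbig_finite // (fsbigID B).
rewrite !split_sum eB; congr (_ + _).
have transfer (E E' : vdiagram z) p : local_change E E' B As ->
    (double_points E `&` ~` B) p ->
    double_points E' p /\ point_weight c E l p = point_weight c E' l p.
  move=> chE [[i [s [j [t [/double_crossing cr <-]]]]] nB].
  have [cr' e] := local_change_crossing chE cr nB.
  split; last by rewrite (point_weightE _ _ cr) -[in RHS]e (point_weightE _ _ cr').
  by exists i, s, j, t; have [d _ _] := cr'.
rewrite (_ : double_points D' `&` ~` B = double_points D `&` ~` B).
  by apply: eq_fsbigr => p /set_mem /(transfer _ _ _ ch) [].
apply/seteqP; split=> p h; split; try by case: h.
  exact: (transfer _ _ _ (local_change_sym ch) h).1.
exact: (transfer _ _ _ ch h).1.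
Qed.

Lemma local_change_arc_disjoint D D' B As A A' i t : local_change D D' B As ->
  A \in As -> A' \in As -> on_arc A i t -> on_arc A' i t -> A = A'.
Proof.
move=> [_ [_ [_ dis]] _ _ _] hA hA' oA oA'; have [//|/eqP ne] := eqVneq A A'.
by case: (dis A A' hA hA' ne i t oA oA').
Qed.

Lemma arc_crossing_passage D D' B As A A' C s t r k cw :
  local_change D D' B As -> A \in As -> A' \in As -> C \in As ->
  arc_crossing D A s A' t k cw -> on_arc C C.1.1 r ->
  str D C.1.1 r = str D A.1.1 s -> (C = A /\ r = s) \/ (C = A' /\ r = t).
Proof.
move=> ch hA hA' hC [oA oA' [d _ _]] oC e.
by have [[ei er]|[ei er]] := double_passage d e; [left|right]; split=> //;
  apply: (local_change_arc_disjoint ch _ _ oC) => //; rewrite ei er.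
Qed.

Lemma arc_crossing_weight D A A' s t k cw l : arc_crossing D A s A' t k cw ->
  point_weight c D l (str D A.1.1 s) = crossing_weight c l A.1.1 A'.1.1 k cw.
Proof. by move=> [_ _ cr]; exact: point_weightE cr. Qed.

Lemma fsbig_set2 (T : choiceType) (x y : T) (F : T -> V) : x <> y ->
  \sum_(p \in [set x; y]) F p = F x + F y.
Proof.
move=> ne; rewrite fsbigU0 ?fsbig_set1 //; try exact: finite_set1.
by move=> p [/= -> /= /ne].
Qed.

Lemma fsbig_set3 (T : choiceType) (x y w : T) (F : T -> V) :
  x <> y -> x <> w -> y <> w ->
  \sum_(p \in [set x; y; w]) F p = F x + F y + F w.
Proof.
move=> xy xw yw; rewrite fsbigU0; first by rewrite fsbig_set1 fsbig_set2.
- exact: finite_set2.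
- exact: finite_set1.
by move=> p /= [[->|->] /=].
Qed.

Lemma three_arcs_point_sum k k' D D' B A0 A1 A2
    s01 s10 s02 s20 s12 s21 c01 c02 c12 l :
  local_change D D' B [:: A0; A1; A2] ->
  three_arcs k k' D B A0 A1 A2 s01 s10 s02 s20 s12 s21 c01 c02 c12 ->
  point_sum_in B D l = crossing_weight c l A0.1.1 A1.1.1 k c01 +
    crossing_weight c l A0.1.1 A2.1.1 k c02 +
    crossing_weight c l A1.1.1 A2.1.1 k' c12.
Proof.
move=> ch [x01 x02 x12 eB].
have m0 : A0 \in [:: A0; A1; A2] by rewrite !inE eqxx.
have m1 : A1 \in [:: A0; A1; A2] by rewrite !inE eqxx orbT.
have m2 : A2 \in [:: A0; A1; A2] by rewrite !inE eqxx !orbT.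
have [n01 n02 n12] : [/\ A0 <> A1, A0 <> A2 & A1 <> A2].
  have [_ [/= u _] _ _ _] := ch.
  by split=> e; rewrite e !inE !eqxx ?orbT /= ?andbF in u.
have [o01 o10 d01] := x01; have [o02 o20 d02] := x02; have [o12 o21 d12] := x12.
have e02 : str D A0.1.1 s02 = str D A2.1.1 s20 by have [[]] := d02.
have e12 : str D A1.1.1 s12 = str D A2.1.1 s21 by have [[]] := d12.
rewrite /point_sum_in eB fsbig_set3.
- by rewrite (arc_crossing_weight l x01) (arc_crossing_weight l x02)
    (arc_crossing_weight l x12).
- rewrite e02 => /esym /(arc_crossing_passage ch m0 m1 m2 x01 o20).
  by case=> -[/esym]; [move=> /n02 | move=> /n12].
- rewrite e12 => /esym /(arc_crossing_passage ch m0 m1 m2 x01 o21).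
  by case=> -[/esym]; [move=> /n02 | move=> /n12].
- move=> /esym /(arc_crossing_passage ch m0 m2 m1 x02 o12).
  by case=> -[]; [move=> /esym /n01 | move=> /n12].
Qed.

(** The three crossings have the same strings, roles and directions on both sides, so any weight is
    preserved. This covers R3, its virtual analogue, the mixed move and OC. *)
Lemma triangle_point_sum k k' D D' l :
  triangle k k' D D' -> point_sum c D l = point_sum c D' l.
Proof.
move=> [B [A0 [A1 [A2 [s01 [s10 [s02 [s20 [s12 [s21]]]]]]]]]].
move=> [t01 [t10 [t02 [t20 [t12 [t21 [c01 [c02 [c12 [ch h h' _]]]]]]]]]].
apply: (local_change_point_sum ch).
by rewrite (three_arcs_point_sum l ch h)
  (three_arcs_point_sum l (local_change_sym ch) h').
Qed.

End PointSum.

Lemma mixed_weight_opp i k cw j : mixed_weight i k (~~ cw) j = - mixed_weight i k cw j.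
Proof.
rewrite /mixed_weight; case: eqP; rewrite ?oppr0 //.
by case: k; case: cw; rewrite /= ?mulrNz ?opprK.
Qed.

(** The only new crossing is a self-crossing, of mixed weight 0. *)
Lemma kink_mixed_sum k D D' l : kink k D D' -> mixed_sum D l = mixed_sum D' l.
Proof.
move=> [B [A [s [t [cw [ch eB x eB']]]]]].
apply: (local_change_point_sum ch); rewrite /point_sum_in eB eB'.
rewrite fsbig_set0 fsbig_set1 (arc_crossing_weight _ l x) /crossing_weight.
by rewrite /mixed_weight !eqxx !mul0rn addr0.
Qed.

(** The two crossings differ only in direction, and [mixed_weight] is odd in the direction. *)
Lemma bigon_mixed_sum k D D' l : bigon k D D' -> mixed_sum D l = mixed_sum D' l.
Proof.
move=> [B [A0 [A1 [s [t [s' [t' [cw [ch eB x x' eB']]]]]]]]].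
apply: (local_change_point_sum ch); rewrite /point_sum_in eB eB'.
have m0 : A0 \in [:: A0; A1] by rewrite !inE eqxx.
have m1 : A1 \in [:: A0; A1] by rewrite !inE eqxx orbT.
rewrite fsbig_set0 fsbig_set2.
  rewrite (arc_crossing_weight _ l x) (arc_crossing_weight _ l x').
  rewrite /crossing_weight !mixed_weight_opp opprK !mulNrn.
  by rewrite addrACA subrr add0r addNr.
have [o _ cr] := x; have [o' _ cr'] := x'.
(* If the two points coincided, either one passage would have both directions [cw] and [~~ cw], or
   the two arcs would be equal. *)
move=> /esym /(arc_crossing_passage (local_change_sym ch) m0 m1 m0 x o').
case=> [[_ es]|[e _]]; last by have [_ [/= u _] _ _ _] := ch; rewrite e inE eqxx in u.
by move: cr'; rewrite es => /(crossing_inj cr) [_ _ _]; case: cw {x x' cr}.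
Qed.

End LocalMoves.

(** * The sign of the Jacobian along an isotopy *)

Section Isotopy.
Context {R : realType}.

Lemma derive_comp (U V W : normedModType R) (f : U -> V) (g : V -> W) x v :
  differentiable f x -> differentiable g (f x) ->
  'D_v (g \o f) x = 'D_('D_v f x) g (f x).
Proof.
move=> df dg; have dgf := differentiable_comp df dg.
by rewrite (deriveE v dgf) diff_comp // [in RHS]deriveE // [in RHS]deriveE.
Qed.

Lemma differentiable_slice (V W : normedModType R) (H : R * V -> W) t p :
  differentiable H (t, p) -> differentiable (fun q => H (t, q)) p.
Proof.
move=> dH; apply: (@differentiable_comp _ V _ W (fun q : V => (t, q)) H) => //.
Qed.

Lemma derive_slice (V W : normedModType R) (H : R * V -> W) t p v :
  'D_v (fun q => H (t, q)) p = 'D_(0, v) H (t, p).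
Proof.
rewrite /derive; set d := (fun _ : R => _); set d' := (fun _ : R => _).
suff -> : d = d' by []; apply/funext => h; rewrite /d /d' /=.
have -> // : h *: ((0, v) : R * V) + (t, p) = (t, h *: v + p).
by congr pair; rewrite /= scaler0 add0r.
Qed.

Lemma det2_linear (a b : R * R) (x y x' y' : R) :
  det2 (x *: a + y *: b) (x' *: a + y' *: b) = (x * y' - y * x') * det2 a b.
Proof.
case: a b => [a1 a2] [b1 b2].
change ((x * a1 + y * b1) * (x' * a2 + y' * b2) -
  (x * a2 + y * b2) * (x' * a1 + y' * b1) =
  (x * y' - y * x') * (a1 * b2 - a2 * b1)).
ring.
Qed.

Lemma det2_scale (a b : R * R) (x y : R) :
  det2 (x *: a) (y *: b) = x * y * det2 a b.
Proof.
case: a b => [a1 a2] [b1 b2].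
change ((x * a1) * (y * b2) - (x * a2) * (y * b1) = x * y * (a1 * b2 - a2 * b1)).
ring.
Qed.

Lemma det2_eq0 (a b : R * R) : det2 a b = 0 ->
  b.2 *: a + (- a.2) *: b = 0 /\ (- b.1) *: a + a.1 *: b = 0.
Proof.
case: a b => [a1 a2] [b1 b2]; rewrite /det2 /= => det0.
split.
  change ((b2 * a1 + - a2 * b1, b2 * a2 + - a2 * b2) = (0, 0) :> R * R).
  by congr pair; [rewrite -det0; ring | ring].
change ((- b1 * a1 + a1 * b1, - b1 * a2 + a1 * b2) = (0, 0) :> R * R).
by congr pair; [ring | rewrite -det0; ring].
Qed.

Lemma basis2 (x y : R) : x *: ((1, 0) : R * R) + y *: ((0, 1) : R * R) = (x, y).
Proof.
change ((x * 1 + y * 0, x * 0 + y * 1) = (x, y)).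
by congr pair; ring.
Qed.

Lemma derive_det2 (h : R * R -> R * R) p u v : differentiable h p ->
  det2 ('D_u h p) ('D_v h p) =
  det2 ('D_(1, 0) h p) ('D_(0, 1) h p) * det2 u v.
Proof.
move=> dh.
have lin w : 'D_w h p = w.1 *: 'D_(1, 0) h p + w.2 *: 'D_(0, 1) h p.
  have e : w = w.1 *: ((1, 0) : R * R) + w.2 *: ((0, 1) : R * R).
    by rewrite basis2; case: w.
  by rewrite !deriveE // {1}e linearD !linearZ.
by rewrite (lin u) (lin v) det2_linear mulrC.
Qed.

(** By the chain rule the derivative of [g] sends the two partial derivatives of [h] back to the
    standard basis, so they are independent. If the determinant vanished, the two dependences of
    [det2_eq0] would make the first of them 0. *)
Lemma jacobian_neq0 (h g : R * R -> R * R) p :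
  differentiable h p -> differentiable g (h p) -> cancel h g ->
  det2 ('D_(1, 0) h p) ('D_(0, 1) h p) <> 0.
Proof.
move=> dh dg hK.
have inv v : 'D_('D_v h p) g (h p) = v.
  rewrite -derive_comp //; have -> : g \o h = id by apply/funext => q /=.
  by rewrite deriveE // diff_val.
have lin (r1 r2 : R) (x y : R * R) :
    'D_(r1 *: x + r2 *: y) g (h p) = r1 *: 'D_x g (h p) + r2 *: 'D_y g (h p).
  by rewrite !deriveE // linearD !linearZ.
have lin0 : 'D_0 g (h p) = 0 by rewrite deriveE // linear0.
move: (inv (1, 0)) (inv (0, 1)).
move: ('D_(1, 0) h p) ('D_(0, 1) h p) => a b ga gb det0.
have [z1 z2] := det2_eq0 det0.
have dep x y : x *: a + y *: b = 0 -> (x, y) = 0.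
  by move=> xy0; rewrite -basis2 -ga -gb -lin xy0 lin0.
have [_ /eqP] := dep _ _ z1; rewrite oppr_eq0 => /eqP a2.
have [_ a1] := dep _ _ z2.
have a0 : a = 0 by rewrite [a]surjective_pairing a1 a2.
by move: ga; rewrite a0 lin0 => -[/esym /eqP]; rewrite oner_eq0.
Qed.

Lemma pos_of_nonzero (f : R -> R) : continuous f -> 0 < f 0 ->
  (forall t, 0 <= t <= 1 -> f t <> 0) -> 0 < f 1.
Proof.
move=> cf f0 nz; rewrite ltNge; apply/negP => f1.
have [|c c01 fc] := @IVT R f 0 1 0 ler01 (continuous_subspaceT cf).
  by rewrite ge_min f1 orbT /= le_max ltW.
by apply: (nz c) fc; rewrite in_itv /= in c01.
Qed.

(** The Jacobian of the slice is continuous in time, equals 1 at time 0 and never vanishes, so it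
    keeps its sign by the intermediate value theorem. *)
Lemma isotopy_jacobian_gt0 (H : R * (R * R) -> R * R) p : smooth H ->
  (forall q, H (0, q) = q) ->
  (forall t, 0 <= t <= 1 -> exists g : R * R -> R * R,
    smooth g /\ cancel (fun q => H (t, q)) g) ->
  0 < det2 ('D_(1, 0) (fun q => H (1, q)) p) ('D_(0, 1) (fun q => H (1, q)) p).
Proof.
move=> sH H0 inv; have [dH cH] := sH 1%N.
pose f t := det2 ('D_(0, (1, 0)) H (t, p)) ('D_(0, (0, 1)) H (t, p)).
have fE t : det2 ('D_(1, 0) (fun q => H (t, q)) p)
    ('D_(0, 1) (fun q => H (t, q)) p) = f t by rewrite !derive_slice.
rewrite fE; apply: pos_of_nonzero.
- have cv (v : R * (R * R)) : continuous (fun t => 'D_v H (t, p)).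
    move=> t; apply: (@continuous_comp _ _ _ (fun t => (t, p)) (fun x => 'D_v H x)).
      have c1 : (fun x : R => x) @ t --> t by exact: cvg_id.
      have c2 : (fun=> p) @ t --> p by exact: cvg_cst.
      exact: (cvg_pair c1 c2).
    exact: cH.
  have c1 v : continuous (fun t => ('D_v H (t, p)).1).
    by move=> t; exact: continuous_comp (cv v t) cvg_fst.
  have c2 v : continuous (fun t => ('D_v H (t, p)).2).
    by move=> t; exact: continuous_comp (cv v t) cvg_snd.
  move=> t; rewrite /f /det2.
  by apply: cvgB; apply: cvgM; [exact: c1|exact: c2|exact: c2|exact: c1].
- rewrite -fE (_ : (fun q => H (0, q)) = id); last exact/funext.
  by rewrite !deriveE // !diff_val /det2 /= mulr1 mulr0 subr0.
move=> t t01; rewrite -fE; have [g [sg gK]] := inv t t01.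
apply: (@jacobian_neq0 (fun q => H (t, q)) g) => //.
  exact/differentiable_slice/smooth_differentiable.
exact: smooth_differentiable.
Qed.

Lemma pos_derive_inj (f : R -> R) : (forall t, differentiable f t) ->
  (forall t, 0 < 'D_1 f t) -> injective f.
Proof.
move=> df pf.
have cf : continuous f by move=> t; exact: differentiable_continuous.
have lt a b : a < b -> f a < f b.
  move=> ab; have [t _|c _ e] := @MVT R f (fun t => 'D_1 f t) a b ab _ (continuous_subspaceT cf).
    by apply: DeriveDef => //; apply/derivable1_diffP.
  by rewrite -subr_gt0 e mulr_gt0 // subr_gt0.
move=> a b e; case: (ltgtP a b) => // /lt; by rewrite e ltxx.
Qed.

End Isotopy.

(** * Invariance under planar isotopy *)

Section IsotopyInvariance.
Context {R : realType} {n : nat} {z : 'I_n -> R}.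
Variables (V : zmodType) (c : 'I_n -> role -> bool -> 'I_n -> V).
Implicit Types (D : vdiagram z) (i j l : 'I_n) (s t : R).

Lemma reindex_point_sum D D' (h : R * R -> R * R) (l l' : 'I_n) :
  injective h ->
  (forall i s j t k cw, crossing D i s j t k cw ->
     exists i' s' j' t', [/\ crossing D' i' s' j' t' k cw,
       str D' i' s' = h (str D i s) &
       crossing_weight c l i j k cw = crossing_weight c l' i' j' k cw]) ->
  (forall p, double_points D' p -> exists2 q, double_points D q & h q = p) ->
  point_sum c D l = point_sum c D' l'.
Proof.
move=> hinj hcr hsurj.
have fD := finite_double_points D; have fD' := finite_double_points D'.
have bij : set_bij (double_points D) (double_points D') h.
  split=> [_ [i [s [j [t [/double_crossing cr <-]]]]]|p q _ _ /hinj //|p /hsurj[q]].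
    have [i' [s' [j' [t' [[d _ _] <- _]]]]] := hcr _ _ _ _ _ _ cr.
    by exists i', s', j', t'.
  by exists q.
rewrite /point_sum -!fsbig_finite // (reindex_fsbig _ _ _ _ bij).
apply: eq_fsbigr => p /set_mem [i [s [j [t [/double_crossing cr <-]]]]].
have [i' [s' [j' [t' [cr' <- e]]]]] := hcr _ _ _ _ _ _ cr.
by rewrite (point_weightE _ _ cr) (point_weightE _ _ cr').
Qed.

(** The final map [h] carries double points bijectively to double points. It sends tangent vectors
    of [D] to positive multiples of those of [D'], so its positive Jacobian preserves the direction
    of each crossing. *)
Lemma isotopic_point_sum D D' l :
  planar_isotopic D D' -> point_sum c D l = point_sum c D' l.
Proof.
move=> iso; have botE := isotopic_bot iso.
have [H [[sH H0] Hout Hinv Hrho Hlab]] := iso.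
pose h q := H (1, q).
have [rho rhoP] := choice Hrho.
have drho i t : differentiable (rho i) t.
  by have [s _ _] := rhoP i; exact: smooth_differentiable.
have crho i : continuous (rho i).
  by move=> t; exact: differentiable_continuous.
have prho i t : 0 < 'D_1 (rho i) t by have [_ p _] := rhoP i.
have rhoE i t : str D' i (rho i t) = h (str D i t) by have [_ _] := rhoP i.
have rho_inj i : injective (rho i) by exact: pos_derive_inj.
(* Outside the open square the isotopy fixes points and the strings are vertical rays parametrized
   by height, so [rho] is the identity there. With the intermediate value theorem on [0,1] this
   makes [rho] surjective. *)
have rho_le0 i t : t <= 0 -> rho i t = t.
  move=> t0; have := rhoE i t; rewrite /h (str_le0 D) // Hout; last first.
    by move=> [_] /= /andP[]; rewrite ltNge t0.
  move=> e; have r0 : rho i t <= 0 by rewrite leNgt -(str_gt0 D' i) e /= -leNgt.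
  by move: e; rewrite str_le0 // => -[].
have rho_ge1 i t : 1 <= t -> rho i t = t.
  move=> t1; have := rhoE i t; rewrite /h (str_ge1 D) // Hout; last first.
    by move=> [_] /= /andP[_]; rewrite ltNge t1.
  move=> e; have r1 : 1 <= rho i t by rewrite leNgt -(str_lt1 D' i) e /= -leNgt.
  by move: e; rewrite str_ge1 // => -[].
have rho_surj i t : exists s, rho i s = t.
  have [t0|/ltW t0] := leP t 0; first by exists t; exact: rho_le0.
  have [t1|/ltW t1] := leP 1 t; first by exists t; exact: rho_ge1.
  have [|s _ e] := @IVT R (rho i) 0 1 t ler01 (continuous_subspaceT (crho i)).
    by rewrite rho_le0 // rho_ge1 // ge_min le_max t0 t1 orbT.
  by exists s.
have [g [sg hK gK]] := Hinv 1 (introT andP (conj ler01 (lexx 1))).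
have dh q : differentiable h q.
  exact/differentiable_slice/smooth_differentiable.
have J q : 0 < det2 ('D_(1, 0) h q) ('D_(0, 1) h q).
  apply: isotopy_jacobian_gt0 => // t /Hinv [g' [sg' gK' _]].
  by exists g'.
have tangent i s : 'D_('D_1 (str D i) s) h (str D i s) =
    'D_1 (rho i) s *: 'D_1 (str D' i) (rho i s).
  have ds E : differentiable (str E i) s by exact/smooth_differentiable/str_smooth.
  rewrite -derive_comp //; have -> : h \o str D i = str D' i \o rho i.
    by apply/funext => r; rewrite /= rhoE.
  have ds' : differentiable (str D' i) (rho i s).
    exact/smooth_differentiable/str_smooth.
  by rewrite derive_comp // derive_scale.
apply: (@reindex_point_sum _ _ h).
- exact: can_inj hK.
- move=> i s j t k cw [[ne e] ec ek].
  exists i, (rho i s), j, (rho j t); split; [|exact: rhoE|reflexivity].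
  split; last by rewrite rhoE Hlab //; exists i, s, j, t.
    split; last by rewrite !rhoE e.
    by move=> [ij]; move: ne; rewrite ij => ne /rho_inj st; apply: ne; rewrite st.
  have E2 := tangent j t; rewrite -e in E2.
  have E := etrans (f_equal2 det2 (esym (tangent i s)) (esym E2))
    (derive_det2 ('D_1 (str D i) s) ('D_1 (str D j) t) (dh (str D i s))).
  rewrite det2_scale in E; rewrite ec.
  have pos_factor (a b x y : R) : 0 < a -> 0 < b -> a * x = b * y -> (0 < y) = (0 < x).
    by move=> a0 b0 exy; rewrite -(pmulr_rgt0 y b0) -exy pmulr_rgt0.
  exact: pos_factor (mulr_gt0 (prho i s) (prho j t)) (J (str D i s)) E.
move=> p [i [s' [j [t' [[ne e] <-]]]]].
have [s es] := rho_surj i s'; have [t et] := rho_surj j t'.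
exists (str D i s); last by rewrite -rhoE es.
exists i, s, j, t; split=> //; split.
  by move=> [ij st]; apply: ne; rewrite -es -et ij st.
apply: (can_inj hK); change (h (str D i s) = h (str D j t)).
by rewrite -!rhoE es et.
Qed.

End IsotopyInvariance.

(** * Invariance under welded equivalence *)

Section Invariance.
Context {R : realType} {n : nat} {z : 'I_n -> R}.
Implicit Types (D : vdiagram z).

Lemma welded_mixed_sum D D' : welded_equiv D D' -> mixed_sum D =1 mixed_sum D'.
Proof.
elim=> {D D'} [D D' m|//|D D' _ e l //|D D' D'' _ e _ e' l]; last by rewrite e.
move=> l; case: m => m; first [exact: isotopic_point_sum | exact: kink_mixed_sum m
  | exact: bigon_mixed_sum m | exact: triangle_point_sum m].
Qed.

Lemma welded_TYM_mx D D' : welded_equiv D D' -> TYM_mx D = TYM_mx D'.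
Proof.
move=> e; rewrite /TYM_mx /tau (welded_bot e); congr monomial_mx.
by apply/funext => j; exact: welded_mixed_sum.
Qed.

End Invariance.

(** * Renaming the indices of the generators *)

Section LamPerm.
Variables (n : nat) (tau : {perm 'I_n}).

Lemma lam_permB : {morph lam_perm tau : w w' / w - w'}.
Proof.
have rearrange (V : zmodType) (a b c a' b' c' : V) :
    (a - a') + (b - b') + (c - c') = (a + b + c) - (a' + b' + c').
  by rewrite !opprD [RHS]addrACA [X in _ = X + _]addrACA.
move=> w w'; rewrite /lam_perm -sumrB; apply: eq_bigr => i _.
by rewrite !ffunE !mulrzBr rearrange.
Qed.

HB.instance Definition _ :=
  GRing.isZmodMorphism.Build (Lam n) (Lam n) (lam_perm tau) lam_permB.

Lemma lam_perm_gen g : lam_perm tau (lam_gen g) =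
  lam_gen (match g with
    | inl (inl j) => inl (inl (tau j))
    | inl (inr j) => inl (inr (tau j))
    | inr j => inr (tau j)
    end).
Proof.
have eqs (i j : 'I_n) : [/\ (inl (inl i) == inl (inl j) :> 'I_n + 'I_n + 'I_n) = (i == j),
    (inl (inr i) == inl (inr j) :> 'I_n + 'I_n + 'I_n) = (i == j) &
    (inr i == inr j :> 'I_n + 'I_n + 'I_n) = (i == j)] by [].
have single j (F : 'I_n -> Lam n) : \sum_i F i *~ (i == j)%:R = F j.
  by rewrite (bigD1 j) //= eqxx mulr1z big1 ?addr0 // => i /negPf ->.
case: g => [[j|j]|j]; rewrite /lam_perm -[RHS](single j (fun i => lam_gen _)) /=;
  apply: eq_bigr => i _; rewrite !ffunE; have [e1 e2 e3] := eqs i j;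
  rewrite ?e1 ?e2 ?e3 /=; rewrite ?mulr0z ?addr0 ?add0r //.
Qed.

Lemma lam_perm_u j : lam_perm tau (lam_u j) = lam_u (tau j).
Proof. exact: lam_perm_gen. Qed.

Lemma lam_perm_v j : lam_perm tau (lam_v j) = lam_v (tau j).
Proof. exact: lam_perm_gen. Qed.

Lemma lam_perm_a j : lam_perm tau (lam_a j) = lam_a (tau j).
Proof. exact: lam_perm_gen. Qed.

Lemma lam_perm_mixed_weight i k cw j :
  lam_perm tau (mixed_weight i k cw j) = mixed_weight (tau i) k cw (tau j).
Proof.
rewrite /mixed_weight (inj_eq perm_inj); case: eqP => _; first exact: raddf0.
case: k; rewrite /lam_weight.
- by rewrite raddfMz /= lam_perm_v.
- by rewrite raddfMz /= lam_perm_u.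
by case: cw; rewrite ?raddfN /= lam_perm_a.
Qed.

Lemma zlam_perm_base k : zlam_perm tau (zbase k) = zbase (lam_perm tau k).
Proof. exact: zext_base. Qed.

Lemma zlam_perm0 : zlam_perm tau 0 = 0.
Proof. exact: raddf0. Qed.

End LamPerm.

(** * The matrix of a concatenation *)

Section ConcatenationSum.
Context {R : realType} {n : nat} {z : 'I_n -> R}.
Variables D D' : vdiagram z.
Implicit Types (i j l : 'I_n) (s t : R) (p : R * R).

Let up : R * R -> R * R := squash 2^-1 0.
Let down : R * R -> R * R := squash 2^-1 2^-1.
Let DD := concat D D'.

(** A meeting at height at least 1 would take place on the vertical rays, which are disjoint since
    [z] is injective. *)
Lemma double_lt1 (E : vdiagram z) i s j t : double E i s j t -> s < 1.
Proof.
move=> [ne e]; rewrite ltNge; apply/negP => s1.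
have t1 : 1 <= t by rewrite leNgt -(str_lt1 E j) -e str_lt1 -leNgt.
move: e; rewrite !str_ge1 // => -[/(z_inj E) /perm_inj ij st].
by apply: ne; rewrite ij st.
Qed.

Lemma double_gt0 (E : vdiagram z) i s j t : double E i s j t -> 0 < s.
Proof.
move=> [ne e]; rewrite ltNge; apply/negP => s0.
have t0 : t <= 0 by rewrite leNgt -(str_gt0 E j) -e str_gt0 -leNgt.
by move: e; rewrite !str_le0 // => -[/(z_inj E) ij st]; apply: ne; rewrite ij st.
Qed.

Lemma squash_inj d : injective (squash 2^-1 d : R * R -> R * R).
Proof.
move=> [x y] [x' y'] [-> /addIr /mulfI e]; congr pair.
by apply: e; rewrite invr_eq0 pnatr_eq0.
Qed.

Let strU i t : t <= 2^-1 -> str DD i t = up (str D i (2 * t + 0)).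
Proof. by rewrite /= /concat_str => ->. Qed.

Let strD i t : 2^-1 < t -> str DD i t = down (str D' (bot D i) (2 * t + - 1)).
Proof. by rewrite /= /concat_str leNgt => ->. Qed.

Let derU i t : t < 2^-1 ->
  'D_1 (str DD i) t = squash 2^-1 0 (2 *: 'D_1 (str D i) (2 * t + 0)).
Proof.
move=> t2; have df := smooth_differentiable (str_smooth D i).
have e : \forall s \near t, up (str D i (2 * s + 0)) = str DD i s.
  near=> s; rewrite strU //; apply: ltW.
  by near: s; exact: lt_nbhsl.
rewrite -(near_eq_derive _ e).
apply: (etrans (derive_rescale _ _ _ (df _))).
by rewrite mulr1 derive_scale.
Unshelve. all: by end_near. Qed.

Let derD i t : 2^-1 < t -> 'D_1 (str DD i) t =
  squash 2^-1 0 (2 *: 'D_1 (str D' (bot D i)) (2 * t + - 1)).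
Proof.
move=> t2; have df := smooth_differentiable (str_smooth D' (bot D i)).
have e : \forall s \near t, down (str D' (bot D i) (2 * s + - 1)) = str DD i s.
  by near=> s; rewrite strD //; near: s; exact: lt_nbhsr.
rewrite -(near_eq_derive _ e).
apply: (etrans (derive_rescale _ _ _ (df _))).
by rewrite mulr1 derive_scale.
Unshelve. all: by end_near. Qed.

(** Doubling the speed and halving the heights scales areas by 2, a positive factor, so directions
    of crossings survive in the concatenation. *)
Lemma det2_squash (u v : R * R) :
  det2 (squash 2^-1 0 (2 *: u)) (squash 2^-1 0 (2 *: v)) = 2 * det2 u v.
Proof.
case: u v => [u1 u2] [v1 v2].
change ((2 * u1) * (2^-1 * (2 * v2) + 0) - (2^-1 * (2 * u2) + 0) * (2 * v1) =
  2 * (u1 * v2 - u2 * v1)).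
by field.
Qed.

Let pos2 (x y : R) : x = 2 * y -> (0 < y) = (0 < x).
Proof. by move=> ->; rewrite pmulr_rgt0. Qed.

Let crossing_up i s j t k cw : crossing D i s j t k cw ->
  crossing DD i (s / 2) j (t / 2) k cw /\ str DD i (s / 2) = up (str D i s).
Proof.
move=> [d -> ->]; have [ne e] := d.
have s1 := double_lt1 d; have t1 := double_lt1 (double_sym d).
have hs : s / 2 < 2^-1 by lra.
have ht : t / 2 < 2^-1 by lra.
have es : 2 * (s / 2) + 0 = s by field.
have et : 2 * (t / 2) + 0 = t by field.
have E1 : str DD i (s / 2) = up (str D i s) by rewrite strU ?es // ltW.
have E2 : str DD j (t / 2) = up (str D j t) by rewrite strU ?et // ltW.
split; last exact: E1.
split.
- split; last by rewrite E1 E2 e.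
  by move=> [ij st]; apply: ne; rewrite ij -es st et.
- have F1 := derU i hs; rewrite es in F1.
  have F2 := derU j ht; rewrite et in F2.
  exact: pos2 (etrans (f_equal2 det2 F1 F2) (det2_squash _ _)).
rewrite E1.
congr role_of; rewrite /= /concat_lab /up /squash /=.
have h : (str D i s).2 < 1 by rewrite str_lt1.
have -> : 2^-1 * (str D i s).2 + 0 <= 2^-1 by lra.
by rewrite (_ : 2 * (_ + 0) = (str D i s).2) -?surjective_pairing //; field.
Qed.

(** String [i] of [D'] is the lower half of the string of the concatenation that starts as string
    [tau D i] of [D]. *)
Let crossing_down i s j t k cw : crossing D' i s j t k cw ->
  crossing DD (tau D i) ((s + 1) / 2) (tau D j) ((t + 1) / 2) k cw /\
  str DD (tau D i) ((s + 1) / 2) = down (str D' i s).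
Proof.
move=> [d -> ->]; have [ne e] := d.
have s0 := double_gt0 d; have t0 := double_gt0 (double_sym d).
have hs : 2^-1 < (s + 1) / 2 by lra.
have ht : 2^-1 < (t + 1) / 2 by lra.
have es : 2 * ((s + 1) / 2) + - 1 = s by field.
have et : 2 * ((t + 1) / 2) + - 1 = t by field.
have bt a : bot D (tau D a) = a by rewrite /tau permKV.
have E1 : str DD (tau D i) ((s + 1) / 2) = down (str D' i s) by rewrite strD ?es ?bt.
have E2 : str DD (tau D j) ((t + 1) / 2) = down (str D' j t) by rewrite strD ?et ?bt.
split; last exact: E1.
split.
- split; last by rewrite E1 E2 e.
  by move=> [/perm_inj ij st]; apply: ne; rewrite ij -es st et.
- have F1 := derD (tau D i) hs; rewrite es bt in F1.
  have F2 := derD (tau D j) ht; rewrite et bt in F2.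
  exact: pos2 (etrans (f_equal2 det2 F1 F2) (det2_squash _ _)).
rewrite E1.
congr role_of; rewrite /= /concat_lab /down /squash /=.
have h : 0 < (str D' i s).2 by rewrite str_gt0.
have -> : (2^-1 * (str D' i s).2 + 2^-1 <= 2^-1) = false.
  by apply/negbTE; rewrite -ltNge; lra.
by rewrite (_ : 2 * _ - 1 = (str D' i s).2) -?surjective_pairing //; field.
Qed.

Lemma concat_double_points :
  double_points DD = up @` double_points D `|` down @` double_points D'.
Proof.
apply/seteqP; split=> p; last first.
  move=> [] [q [i [s [j [t [/double_crossing cr <-]]]]] <-].
    have [[d _ _] e] := crossing_up cr.
    by exists i, (s / 2), j, (t / 2).
  have [[d _ _] e] := crossing_down cr.
  by exists (tau D i), ((s + 1) / 2), (tau D j), ((t + 1) / 2).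
move=> [i [s [j [t [[ne e] <-]]]]].
have [[s2 [t2 e']]|[s2 [t2 e']]] := concat_meet e.
  left; exists (str D i (2 * s)); last by rewrite strU // addr0.
  exists i, (2 * s), j, (2 * t); split=> //; split=> // -[ij st].
  by apply: ne; rewrite ij; congr pair; lra.
have d : double D' (bot D i) (2 * s - 1) (bot D j) (2 * t - 1).
  split=> // -[/perm_inj ij st].
  by apply: ne; rewrite ij; congr pair; lra.
right; exists (str D' (bot D i) (2 * s - 1)).
  by exists (bot D i), (2 * s - 1), (bot D j), (2 * t - 1).
by rewrite strD //; have := double_gt0 d; lra.
Qed.

(** The upper crossings keep their strings. The lower ones have theirs renamed by [tau D], and
    string [l] runs there along string [bot D l] of [D']. *)
Lemma concat_mixed_sum l : mixed_sum DD l =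
  mixed_sum D l + lam_perm (tau D) (mixed_sum D' (bot D l)).
Proof.
have fD := finite_double_points D; have fD' := finite_double_points D'.
have fDD := finite_double_points DD.
rewrite /mixed_sum /point_sum -fsbig_finite // concat_double_points fsbigU0.
- rewrite !fsbig_image; try by move=> p q _ _ /squash_inj.
  rewrite raddf_sum /= -!fsbig_finite //; congr (_ + _).
    apply: eq_fsbigr => _ /set_mem [i [s [j [t [/double_crossing cr <-]]]]].
    have [cr' <-] := crossing_up cr.
    by rewrite (point_weightE _ _ cr) (point_weightE _ _ cr').
  apply: eq_fsbigr => _ /set_mem [i [s [j [t [/double_crossing cr <-]]]]].
  have [cr' <-] := crossing_down cr.
  rewrite (point_weightE _ _ cr) (point_weightE _ _ cr') /crossing_weight.
  rewrite raddfD !raddfMn /= !lam_perm_mixed_weight.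
  have swap a : (l == tau D a) = (bot D l == a).
    by rewrite /tau; apply/eqP/eqP => [->|<-]; rewrite ?permKV ?permK.
  by rewrite !swap.
- exact: finite_image.
- exact: finite_image.
(* The two families are disjoint: upper double points have height below 1/2, lower ones above. *)
move=> p [[q [i [s [j [t [d <-]]]]] <-] [q' [i' [s' [j' [t' [d' <-]]]]]]].
move=> /(congr1 snd); rewrite /up /down /squash /=.
have h : (str D i s).2 < 1 by rewrite str_lt1 (double_lt1 d).
have h' : 0 < (str D' i' s').2 by rewrite str_gt0 (double_gt0 d').
by lra.
Qed.

(** In column [j] of the product only the index [tau D' j] survives. It is the lower half of the
    string ending at [j], whose upper half is [tau D (tau D' j)]. *)
Lemma concat_TYM_mx :
  TYM_mx DD = TYM_mx D *m map_mx (zlam_perm (tau D)) (TYM_mx D').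
Proof.
have tauE j : tau DD j = tau D (tau D' j) by rewrite /tau /= invgM permM.
apply/matrixP => i j; rewrite !mxE (bigD1 (tau D' j)) //= big1 ?addr0.
  rewrite !mxE eqxx mul1r zlam_perm_base tauE -mulrA -zbaseD.
  by rewrite concat_mixed_sum /tau permKV.
move=> k /negPf nk; rewrite !mxE nk mul0r; apply: etrans (mulr0 _).
congr (_ * _); exact: zlam_perm0.
Qed.

End ConcatenationSum.

(* The first clause states that the matrix is well-defined (it exists, is     *)
(* unique, and lies in GL_n); wTYM itself is a choice of such a matrix.       *)
Theorem theorem4p7 (R : realType) (n : nat) (z : 'I_n -> R)
  (n_ge1 : (1 <= n)%N)
  (z_in01 : forall i : 'I_n, 0 < z i < 1)
  (z_incr : forall i j : 'I_n, (i < j)%N -> z i < z j) :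
  [/\ forall D : vdiagram z,
        (forall M, is_wTYM D M <-> M = wTYM D) /\ in_GL (wTYM D),
      forall D D' : vdiagram z, welded_equiv D D' -> wTYM D = wTYM D' &
      forall D D' : vdiagram z,
        wTYM (concat D D') =
          wTYM D *m map_mx (zlam_perm (tau D)) (wTYM D')].
Proof.
split=> [D|D D' /welded_TYM_mx e|D D'].
- split=> [M|]; first by rewrite wTYME; exact: is_wTYME.
  by rewrite wTYME; exact: in_GL_monomial_mx.
- by rewrite !wTYME.
by rewrite !wTYME concat_TYM_mx.
Qed.
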